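(* Fix $\delta > 0$, $K \ge 0$ and $p > 0$. Consider $(m,n) \in S_\delta \cap \mathbb{Z}_{>0}^2$ and $z \in (0,1)$ with $$|z - \zeta(m,n)| \le K(m+n)^{-1/3-p}. \qquad ( * )$$ The following statements hold. (a) Fix $s_0 > 0$. There are constants $C_0 = C_0(\delta) > 0$, $\epsilon_0 = \epsilon_0(\delta) > 0$ and $N_0 = N_0(\delta, K, p, s_0) > 0$ such that, for all such $(m,n)$ and $z$ satisfying $( * )$, $$\log \mathbf{P}\{\hat G^z(m,n) \ge \gamma(m,n) + \sigma(m,n)s\} \le -\frac{2s^{3/2}}{3} + \log 2 + \frac{C_0 K s}{(m+n)^p} + \frac{C_0 s^2}{(m+n)^{1/3}}$$ whenever $s \in [s_0, \epsilon_0(m+n)^{2/3}]$ and $m,n \ge N_0$. (b) There are constants $C_1 = C_1(\delta) > 0$, $\epsilon_1 = \epsilon_1(\delta) > 0$, $N_1 = N_1(\delta,K,p) > 0$, and absolute constants $s_1 > 0$ and $\eta > 0$ such that, for all such $(m,n)$ and $z$ satisfying $( * )$, $$\log \mathbf{P}\{\hat G^z(m,n) \ge \gamma(m,n) + \sigma(m,n)s\} \ge -\frac{2s^{3/2}}{3} - \eta s - \frac{C_1 s^2}{(m+n)^{1/3}}$$ for $s \in [s_1, \epsilon_1(m+n)^{2/3}]$ and $m,n \ge N_1$.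
   Context: Notation $C = C(a,b)$ means that the constant depends only on the listed parameters. $\mathrm{Exp}(\lambda)$ denotes the exponential distribution with rate $\lambda>0$. An up-right path is a finite sequence in $\mathbb{Z}^2$ with steps in $\{(1,0),(0,1)\}$; $\Pi_{p,q}^{m,n}$ is the set of up-right paths from $(p,q)$ to $(m,n)$. For $z\in(0,1)$ let $\{\hat\omega^z(i,j): i,j\in\mathbb{Z}_{\ge0}\}$ be independent with $\hat\omega^z(0,0)=0$, $\hat\omega^z(i,j)\sim\mathrm{Exp}(1)$ for $i,j>0$, $\hat\omega^z(i,0)\sim\mathrm{Exp}(z)$ for $i>0$, $\hat\omega^z(0,j)\sim\mathrm{Exp}(1-z)$ for $j>0$. The increment-stationary last-passage time is $\hat G^z(m,n) = \max_{\pi\in\Pi_{0,0}^{m,n}}\sum_{(i,j)\in\pi}\hat\omega^z(i,j)$. For $x,y>0$: $\gamma(x,y) = (\sqrt{x}+\sqrt{y})^2$, $\zeta(x,y) = \dfrac{\sqrt{x}}{\sqrt{x}+\sqrt{y}}$, $\sigma(x,y) = \dfrac{(\sqrt{x}+\sqrt{y})^{4/3}}{x^{1/6}y^{1/6}}$. $S_\delta = \{(x,y)\in\mathbb{R}_{>0}^2: x\ge\delta y,\ y\ge\delta x\}$. *)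

(* Defs.v *)
From HB Require Import structures.
From mathcomp Require Import all_boot all_order all_algebra.
From mathcomp Require Import all_classical all_reals all_analysis.
Set Implicit Arguments.
Unset Strict Implicit.
Unset Printing Implicit Defensive.
Import Order.TTheory GRing.Theory Num.Theory.
Import numFieldNormedType.Exports.
Local Open Scope classical_set_scope.
Local Open Scope ring_scope.

(* Up-right paths between points of the quadrant never leave it, so lattice
   points with coordinates in nat suffice. *)
Definition up_right_step (u v : nat * nat) : bool :=
  (v == (u.1.+1, u.2)) || (v == (u.1, u.2.+1)).

Definition up_right_paths (u v : nat * nat) : set (seq (nat * nat)) :=
  [set pi | exists s, [/\ pi = u :: s, path up_right_step u s & last u s = v]].

(* The set of path weights is finite and nonempty, so its supremum is the
   maximum. *)
Definition last_passage (R : realType) (w : nat * nat -> R) (m n : nat) : R :=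
  sup [set \sum_(v <- pi) w v | pi in up_right_paths (0, 0)%N (m, n)].

Definition mutually_independent d (T : measurableType d) (R : realType)
    (P : probability T R) (I : eqType) (X : I -> {RV P >-> R}) : Prop :=
  forall (J : seq I) (B : I -> set R), uniq J ->
    (forall i, measurable (B i)) ->
    P (\bigcap_(i in [set` J]) (X i @^-1` B i)) =
      (\prod_(i <- J) P (X i @^-1` B i))%E.

Definition exponentially_distributed d (T : measurableType d) (R : realType)
    (P : probability T R) (X : {RV P >-> R}) (rate : R) : Prop :=
  forall B : set R, measurable B -> distribution P X B = exponential_prob rate B.

Definition increment_stationary_weights d (T : measurableType d)
    (R : realType) (P : probability T R) (z : R)
    (w : nat * nat -> {RV P >-> R}) : Prop :=
  [/\ mutually_independent w,
      forall t, w (0, 0)%N t = 0,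
      forall i j, (0 < i)%N -> (0 < j)%N ->
        exponentially_distributed (w (i, j)) 1,
      forall i, (0 < i)%N -> exponentially_distributed (w (i, 0%N)) z
    & forall j, (0 < j)%N -> exponentially_distributed (w (0%N, j)) (1 - z)].

Definition Ghat d (T : measurableType d) (R : realType)
    (P : probability T R) (w : nat * nat -> {RV P >-> R}) (m n : nat) (t : T) : R :=
  last_passage (fun v => w v t) m n.

Section shape.
Context {R : realType}.
Implicit Types x y delta : R.

Definition gamma x y : R := (Num.sqrt x + Num.sqrt y) ^+ 2.

Definition zeta x y : R := Num.sqrt x / (Num.sqrt x + Num.sqrt y).

Definition sigma x y : R :=
  (Num.sqrt x + Num.sqrt y) `^ (4 / 3) / (x `^ (1 / 6) * y `^ (1 / 6)).

Definition cone delta : set (R * R) :=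
  [set u | [/\ 0 < u.1, 0 < u.2, delta * u.2 <= u.1 & delta * u.1 <= u.2]].

End shape.

Definition admissible (R : realType) (delta K p : R) (m n : nat) (z : R) : Prop :=
  [/\ (0 < m)%N /\ (0 < n)%N, cone delta (m%:R, n%:R), 0 < z < 1
    & `|z - zeta m%:R n%:R| <= K * (m%:R + n%:R) `^ (- (1 / 3) - p)].

(* Main.v *)
Require Import Defs.
From HB Require Import structures.
From mathcomp Require Import all_boot all_order all_algebra.
From mathcomp Require Import all_classical all_reals all_analysis.
From mathcomp Require Import measurable_realfun ring lra.
Set Implicit Arguments.
Unset Strict Implicit.
Unset Printing Implicit Defensive.
Import Order.TTheory GRing.Theory Num.Theory.
Import numFieldNormedType.Exports.
Import HBNNSimple.
Local Open Scope classical_set_scope.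
Local Open Scope ring_scope.

(** Give the horizontal axis the rate a and the vertical axis the rate b, with
    a, b in (0, 1) now unrelated, and let L be the last-passage time from the
    origin to (m, n).  Everything rests on one exact formula, [lpp_mgf]:
      E exp ((a + b - 1) L) = (a / (1 - b)) ^ m * (b / (1 - a)) ^ n.
    When a + b = 1 the increments of L along any down-right lattice path are
    independent exponentials (Burke's property, [burke]).  The general case
    follows by exponential tilting.  Write L as the sum of the m horizontal
    increments along the lower side of the rectangle and the n vertical ones
    along its right side.  Tilting the former turns the rate a into 1 - b,
    which is the stationary situation; there the latter are independent of
    rate b, and tilting them costs the second factor.

    Writing a = c + u / sigma and 1 - b = c + v / sigma with c = zeta (m, n),
    the logarithm of the right-hand side becomes
    gamma (u - v) / sigma + f u - f v, where f (the function [rate]) is u^3 / 3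
    up to an error of order u^4 / sigma ([boundary_mgfE], [rate_near_cube]).
    The assumption on z says that z = c + k / sigma with k tending to 0.

    Upper bound.  A path to (m, n) leaves the origin along one of the axes, so
    the passage time is the maximum of the two obtained by zeroing one axis.
    Each of these two variables no longer feels the rate of the axis that was
    zeroed, so that rate may be chosen freely: Markov's inequality and the
    formula with v = - sqrt s, respectively u = sqrt s, bound each tail by
    exp (- 2 s^(3/2) / 3) up to the stated errors.  The term ln 2 is the union
    bound ([Ghat_tail_le], [upper_tail]).

    Lower bound.  The formula is now used as an exact evaluation.  With rate z
    horizontally and b = 1 - c + V / sigma vertically, V slightly above the
    value at which the exponential moment is carried by the event that the
    passage time is near gamma + sigma s, the moment is split according to the
    place of the passage time.  The parts below gamma + sigma s, above
    gamma + sigma s', and those where the path profits from the vertical axis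
    are each bounded by the formula at a neighbouring parameter, and each is at
    most an eighth of the whole ([lower_tail_exponents]).  What remains is at
    most exp ((k + V) (gamma / sigma + s')) times the wanted probability
    ([Ghat_tail_ge], [lower_tail]). *)

(** * Last-passage times by recursion *)

Section lpp.
Context {R : realType}.
Implicit Types (w : nat * nat -> R) (m n : nat).

(** The last step into (m, n) comes from the left or from below. In this
    recursive form the increments of the passage time can be followed across a
    unit square, which is what Burke's property is about. *)
Fixpoint lpp w m n : R :=
  match m with
  | 0 => (fix col n := match n with
                       | 0 => w (0, 0)%N
                       | n'.+1 => col n' + w (0%N, n)
                       end) n
  | m'.+1 => (fix col n := match n with
                           | 0 => lpp w m' 0%N + w (m, 0%N)
                           | n'.+1 => Num.max (lpp w m' n) (col n') + w (m, n)
                           end) n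
  end.

Lemma lpp0S w n : lpp w 0 n.+1 = lpp w 0 n + w (0, n.+1)%N.
Proof. by []. Qed.

Lemma lppS0 w m : lpp w m.+1 0 = lpp w m 0 + w (m.+1, 0)%N.
Proof. by []. Qed.

Lemma lppSS w m n :
  lpp w m.+1 n.+1 = Num.max (lpp w m n.+1) (lpp w m.+1 n) + w (m.+1, n.+1).
Proof. by []. Qed.

Lemma path_weight_le_lpp w s : path up_right_step (0, 0)%N s ->
  \sum_(v <- (0, 0)%N :: s) w v <=
  lpp w (last (0, 0)%N s).1 (last (0, 0)%N s).2.
Proof.
elim/last_ind: s => [|s v IH]; first by rewrite big_seq1.
rewrite rcons_path last_rcons -rcons_cons big_rcons/= => /andP[/IH].
case: (last _ s) => i j /= {}IH /orP[]/eqP->/=.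
  rewrite -[X in _ <= X]/(lpp w i.+1 j).
  by case: j IH => [|j] IH; rewrite ?lppS0 ?lppSS lerD2r// le_max IH.
case: i IH => [|i] IH; first by rewrite lpp0S lerD2r.
by rewrite lppSS lerD2r le_max IH orbT.
Qed.

Lemma lpp_path w m n :
  exists2 s, path up_right_step (0, 0)%N s & last (0, 0)%N s = (m, n) /\
    \sum_(v <- (0, 0)%N :: s) w v = lpp w m n.
Proof.
have ext s u v : path up_right_step (0, 0)%N s -> last (0, 0)%N s = u ->
    up_right_step u v ->
    exists2 s', path up_right_step (0, 0)%N s' & last (0, 0)%N s' = v /\
    \sum_(v <- (0, 0)%N :: s') w v = \sum_(v <- (0, 0)%N :: s) w v + w v.
  move=> ps su uv; exists (rcons s v); first by rewrite rcons_path ps su.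
  by rewrite last_rcons -rcons_cons big_rcons/= addrC.
have stepr i j : up_right_step (i, j) (i.+1, j) by rewrite /up_right_step eqxx.
have stepu i j : up_right_step (i, j) (i, j.+1).
  by rewrite /up_right_step eqxx orbT.
elim: m n => [|m IHm]; elim=> [|n IHn].
- by exists [::] => //=; rewrite big_seq1.
- have [s ps [ls ws]] := IHn.
  by have [s' ps' [ls' ws']] := ext _ _ _ ps ls (stepu _ _); exists s'; rewrite // ws' ws.
- have [s ps [ls ws]] := IHm 0%N.
  by have [s' ps' [ls' ws']] := ext _ _ _ ps ls (stepr _ _); exists s'; rewrite // ws' ws.
- have [s1 ps1 [ls1 ws1]] := IHm n.+1; have [s2 ps2 [ls2 ws2]] := IHn.
  rewrite lppSS; case: (leP (lpp w m n.+1) (lpp w m.+1 n)) => _.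
    by have [s' ps' [ls' ws']] := ext _ _ _ ps2 ls2 (stepu _ _); exists s'; rewrite // ws' ws2.
  by have [s' ps' [ls' ws']] := ext _ _ _ ps1 ls1 (stepr _ _); exists s'; rewrite // ws' ws1.
Qed.

(** The recursive value bounds the weight of every path, and the path that
    backtracks through the maxima attains it. *)
Lemma last_passageE w m n : last_passage w m n = lpp w m n.
Proof.
rewrite /last_passage; set A := (X in sup X).
have Aub : ubound A (lpp w m n).
  move=> _ [_ [s [-> ps ls]] <-].
  by have := path_weight_le_lpp w ps; rewrite ls.
have Alpp : A (lpp w m n).
  have [s ps [ls ws]] := lpp_path w m n.
  by exists ((0, 0)%N :: s) => //; exists s.
apply/eqP; rewrite eq_le; apply/andP; split.
  by apply: ge_sup => //; exists (lpp w m n).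
by apply: ub_le_sup => //; exists (lpp w m n).
Qed.

Lemma le_lpp w1 w2 m n : (forall v, w1 v <= w2 v) -> lpp w1 m n <= lpp w2 m n.
Proof.
move=> w12; elim: m n => [|m IHm]; elim=> [|n IHn].
- exact: w12.
- by rewrite !lpp0S lerD.
- by rewrite !lppS0 lerD.
- by rewrite !lppSS lerD// ge_max !le_max IHn IHm orbT.
Qed.

Definition zero_vertical w : nat * nat -> R :=
  fun v => if v.1 == 0%N then 0 else w v.

Definition zero_horizontal w : nat * nat -> R :=
  fun v => if v.2 == 0%N then 0 else w v.

(** A path whose first step is horizontal never returns to the vertical axis,
    so erasing the weights of that axis leaves its weight unchanged; likewise
    with the axes exchanged. *)
Lemma lpp_le_max_zero w m n : w (0, 0)%N = 0 ->
  lpp w m n <= Num.max (lpp (zero_vertical w) m n) (lpp (zero_horizontal w) m n).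
Proof.
move=> w00; elim: m n => [|m IHm]; elim=> [|n IHn].
- by rewrite /= w00 le_max /zero_vertical lexx.
- rewrite le_max; apply/orP; right.
  have: lpp w 0 n <= lpp (zero_horizontal w) 0 n.
    elim: n {IHn} => [|n IHn]; first by rewrite /= w00.
    by rewrite !lpp0S /zero_horizontal/= lerD2r.
  by rewrite !lpp0S /zero_horizontal/= lerD2r.
- rewrite le_max; apply/orP; left.
  have: lpp w m 0 <= lpp (zero_vertical w) m 0.
    elim: m {IHm} => [|m IHm]; first by rewrite /= w00.
    by rewrite !lppS0 /zero_vertical/= lerD2r.
  by rewrite !lppS0 /zero_vertical/= lerD2r.
- rewrite !lppSS {3}/zero_vertical {3}/zero_horizontal/= -addr_maxl lerD2r.
  rewrite ge_max; apply/andP; split.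
    apply: (le_trans (IHm n.+1)); rewrite ge_max !le_max !lexx/=.
    by rewrite !orbT.
  apply: (le_trans IHn); rewrite ge_max !le_max !lexx/=.
  by rewrite !orbT.
Qed.

End lpp.

(** * Densities and Lebesgue measure *)

Section density.
Local Open Scope ereal_scope.
Context d (T : measurableType d) (R : realType).

(** Both sides are monotone limits along simple functions, for which the
    identity is the hypothesis on measurable sets. *)
Lemma ge0_integral_density (m1 m2 : {measure set T -> \bar R}) (g : T -> R) :
    measurable_fun setT g -> (forall x, 0 <= g x)%R ->
    (forall A, measurable A -> m2 A = \int[m1]_(x in A) (g x)%:E) ->
  forall f : T -> \bar R, measurable_fun setT f -> (forall x, 0 <= f x) ->
    \int[m2]_x f x = \int[m1]_x (f x * (g x)%:E).
Proof.
move=> mg g0 m2E f mf f0.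
pose h := nnsfun_approx measurableT mf.
have mgE : measurable_fun setT (EFin \o g) by exact/measurable_EFinP.
have -> : \int[m2]_x f x = lim (\int[m2]_x (EFin \o h n) x @[n --> \oo]).
  have fE x : f x = lim ((EFin \o h n) x @[n --> \oo]).
    by apply/esym/cvg_lim => //; exact: cvg_nnsfun_approx.
  under eq_integral => x _ do rewrite fE.
  apply: monotone_convergence => //.
  - by move=> n; exact/measurable_EFinP.
  - by move=> n x Ex //=; rewrite lee_fin.
  - by move=> x Ex a b ab; rewrite lee_fin; exact/lefP/nd_nnsfun_approx.
have -> : \int[m1]_x (f x * (g x)%:E) =
    lim (\int[m1]_x ((EFin \o h n) x * (g x)%:E) @[n --> \oo]).
  have fE x : f x * (g x)%:E = lim ((EFin \o h n) x * (g x)%:E @[n --> \oo]).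
    by apply/esym/cvg_lim => //; apply: cvgeZr => //; exact: cvg_nnsfun_approx.
  under eq_integral => x _ do rewrite fE.
  apply: monotone_convergence => //.
  - by move=> n; apply: emeasurable_funM => //; exact/measurable_EFinP.
  - by move=> n x Ex //=; rewrite mule_ge0// lee_fin.
  - move=> x Ex a b ab; rewrite lee_wpmul2r ?lee_fin//.
    exact/lefP/nd_nnsfun_approx.
suff suf n : \int[m2]_x (EFin \o h n) x = \int[m1]_x ((EFin \o h n) x * (g x)%:E).
  by under eq_fun do rewrite suf.
rewrite integralT_nnsfun sintegralE.
under [RHS]eq_integral => x _.
  rewrite /= fimfunE -fsumEFin// ge0_mule_fsuml; last first.
    by move=> y; exact: nnfun_muleindic_ge0.
  over.
rewrite ge0_integral_fsum//; last 2 first.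
  - move=> y; apply: emeasurable_funM => //; apply/measurable_EFinP.
    by apply: measurable_funM => //; exact: measurable_indic.
  - by move=> y x _; rewrite mule_ge0 ?nnfun_muleindic_ge0// lee_fin.
apply: eq_fsbigr => y; rewrite inE => -[t _ <-].
under eq_integral do rewrite EFinM -muleA.
rewrite ge0_integralZl//; last 3 first.
  - apply: emeasurable_funM => //; apply/measurable_EFinP.
    exact: measurable_indic.
  - by move=> x _; rewrite mule_ge0// lee_fin.
  - by rewrite lee_fin.
congr (_ * _).
rewrite m2E// integral_mkcond; apply: eq_integral => x _.
by rewrite epatch_indic muleC.
Qed.

End density.

Section affine.
Local Open Scope ereal_scope.
Context {R : realType}.
Local Notation mu := (@lebesgue_measure R).

(** The image of Lebesgue measure under the affine map, scaled by [k], has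
    the right value on half-open intervals, and these determine it. *)
Lemma lebesgue_measure_affine (k c : R) (A : set R) : (0 < k)%R -> measurable A ->
  mu A = k%:E * mu [set x | A (k * x + c)%R].
Proof.
move=> k0 mA.
pose f : measurableTypeR R -> measurableTypeR R := fun x => (k * x + c)%R.
have mf : measurable_fun setT f by apply: measurable_funD => //; exact: measurable_funM.
pose M := [the measure _ _ of pushforward mu f].
rewrite -[RHS]/(mscale (NngNum (ltW k0)) (M mf) A).
apply: lebesgue_measure_unique => //= _ [[a b]] _ <-.
rewrite /mscale/= /pushforward.
have -> : f @^-1` `]a, b] = `]((a - c) / k)%R, ((b - c) / k)%R]%classic.
  apply/seteqP; split=> x /=; rewrite !in_itv/= /f ltr_pdivrMr// ler_pdivlMr//;
    rewrite ltrBlDr lerBrDr mulrC; exact.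
rewrite !lebesgue_measure_itv/= !lte_fin ltr_pM2r ?invr_gt0// ltrD2r.
case: ifPn => _; last by rewrite mule0.
by rewrite -!EFinD -EFinM; congr EFin; field; rewrite gt_eqF.
Qed.

End affine.

(** * The exponential law *)

Section lebesgue_borel.
Local Open Scope ereal_scope.
Context {R : realType}.

(** Lebesgue measure for the default measurable structure of [R], which is the
    one that random variables and product measures use; the sigma-algebra of
    [lebesgue_measure] is the same, but indexed by another display. *)
Definition lebesgue (A : set R) : \bar R := @lebesgue_measure R A.

Let lebesgue0 : lebesgue set0 = 0. Proof. exact: measure0. Qed.
Let lebesgue_ge0 A : 0 <= lebesgue A. Proof. exact: measure_ge0. Qed.
Let lebesgue_sigma_additive : semi_sigma_additive lebesgue.
Proof. exact: (@measure_semi_sigma_additive _ _ _ (@lebesgue_measure R)). Qed.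

HB.instance Definition _ := isMeasure.Build _ _ _ lebesgue lebesgue0 lebesgue_ge0 lebesgue_sigma_additive.

Lemma integral_lebesgueE (A : set R) (f : R -> \bar R) : measurable A ->
    measurable_fun setT f -> (forall x, 0 <= f x) ->
  \int[@lebesgue_measure R]_(x in A) f x = \int[lebesgue]_(x in A) f x.
Proof.
move=> mA mf f0.
pose g : measurableTypeR R -> R := fun x => x.
have mg : measurable_fun setT g by move=> _ Y mY; rewrite setTI.
pose M := [the measure _ _ of pushforward (@lebesgue_measure R) g].
transitivity (\int[M mg]_(x in A) f x); last exact: eq_measure_integral.
rewrite ge0_integral_pushforward//.
exact: measurable_funTS.
Qed.

Lemma ge0_integral_lebesgue_affine (k c : R) (f : R -> \bar R) : (0 < k)%R ->
    measurable_fun setT f -> (forall x, 0 <= f x) ->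
  \int[lebesgue]_x f x = k%:E * \int[lebesgue]_x f (k * x + c)%R.
Proof.
move=> k0 mf f0.
pose g : R -> R := fun x => (k * x + c)%R.
have mg : measurable_fun setT g by apply: measurable_funD => //; exact: measurable_funM.
pose M := [the measure _ _ of pushforward lebesgue g].
have := @ge0_integral_pushforward _ _ _ _ _ g mg lebesgue setT f measurableT (measurable_funTS mf) (fun x _ => f0 x).
rewrite preimage_setT => <-.
rewrite -(@ge0_integral_mscale _ _ _ (M mg) setT measurableT (NngNum (ltW k0)) f)//.
apply: eq_measure_integral => A mA _.
exact: lebesgue_measure_affine.
Qed.
End lebesgue_borel.

Section exponential_law.
Local Open Scope ereal_scope.
Context {R : realType}.
Local Notation mu := (@lebesgue_measure R).
Implicit Types (r : {posnum R}) (A : set R) (f : R -> \bar R).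

(** Positivity of the rate is part of its type, so that the law is a
    probability measure by inference. *)
Definition exp_law r (A : set R) : \bar R := exponential_prob r%:num A.

Let exp_law0 r : exp_law r set0 = 0. Proof. exact: measure0. Qed.
Let exp_law_ge0 r A : 0 <= exp_law r A. Proof. exact: measure_ge0. Qed.
Let exp_law_sigma_additive r : semi_sigma_additive (exp_law r).
Proof.
exact: (@measure_semi_sigma_additive _ _ _ (@exponential_prob R r%:num)).
Qed.

HB.instance Definition _ r := isMeasure.Build _ _ _ (exp_law r)
  (exp_law0 r) (exp_law_ge0 r) (@exp_law_sigma_additive r).

Let exp_law_setT r : exp_law r setT = 1.
Proof. exact: integral_exponential_pdf. Qed.

HB.instance Definition _ r :=
  Measure_isProbability.Build _ _ R (exp_law r) (exp_law_setT r).

Lemma exp_law_density r A : measurable A ->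
  exp_law r A = \int[lebesgue]_(x in A) (exponential_pdf r%:num x)%:E.
Proof.
move=> mA; rewrite -integral_lebesgueE//.
- by apply/measurable_EFinP; exact: measurable_exponential_pdf.
- by move=> x; rewrite lee_fin exponential_pdf_ge0.
Qed.

Lemma ge0_integral_exp_law r f : measurable_fun setT f -> (forall x, 0 <= f x) ->
  \int[exp_law r]_x f x = \int[lebesgue]_x (f x * (exponential_pdf r%:num x)%:E).
Proof.
apply: ge0_integral_density.
- exact: measurable_exponential_pdf.
- by move=> x; exact: exponential_pdf_ge0.
- by move=> A mA; exact: exp_law_density.
Qed.

End exponential_law.

Section exponential_law_identities.
Local Open Scope ereal_scope.
Context {R : realType}.
Implicit Types (r : {posnum R}) (A : set R) (f : R -> \bar R).

Lemma exp_law_indic r A : measurable A ->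
  exp_law r A = \int[lebesgue]_x (\1_A x * exponential_pdf r%:num x)%:E.
Proof.
move=> mA; rewrite exp_law_density// integral_mkcond.
by apply: eq_integral => x _; rewrite epatch_indic EFinM muleC.
Qed.

Let mpdf r A : measurable A ->
  measurable_fun setT (fun x : R => (\1_A x * exponential_pdf r%:num x)%:E).
Proof.
move=> mA; apply/measurable_EFinP/measurable_funM; first exact: measurable_indic.
exact: measurable_exponential_pdf.
Qed.

Let pdf_ge0 r A (x : R) : 0 <= (\1_A x * exponential_pdf r%:num x)%:E.
Proof. by rewrite lee_fin mulr_ge0// exponential_pdf_ge0. Qed.

Lemma eq_integral_exp_law r (f g : R -> \bar R) :
    measurable_fun setT f -> measurable_fun setT g ->
    (forall x, 0 <= f x) -> (forall x, 0 <= g x) ->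
    (forall x, (0 <= x)%R -> f x = g x) ->
  \int[exp_law r]_x f x = \int[exp_law r]_x g x.
Proof.
move=> mf mg f0 g0 fg; rewrite !ge0_integral_exp_law//.
apply: eq_integral => x _; have [x0|x0] := leP 0%R x; first by rewrite fg.
by rewrite lt0_exponential_pdf// !mule0.
Qed.

(** On the half-line, r exp (- r x) exp ((r - r') x) is r / r' times the
    density of rate r'. Every change of rate below goes through this. *)
Lemma exp_law_tilt (r r' : {posnum R}) f :
    measurable_fun setT f -> (forall x, 0 <= f x) ->
  \int[exp_law r]_x (f x * (expR ((r%:num - r'%:num) * x))%:E) =
  (r%:num / r'%:num)%:E * \int[exp_law r']_x f x.
Proof.
move=> mf f0.
have mpdf' s : measurable_fun setT (EFin \o exponential_pdf (s : {posnum R})%:num).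
  by apply/measurable_EFinP; exact: measurable_exponential_pdf.
rewrite !ge0_integral_exp_law//; last 2 first.
- apply: emeasurable_funM => //; apply/measurable_EFinP.
  by apply: measurableT_comp => //; exact: measurable_funM.
- by move=> x; rewrite mule_ge0// lee_fin expR_ge0.
rewrite -ge0_integralZl//; last 2 first.
- exact: (emeasurable_funM mf (mpdf' r')).
- by move=> x _; rewrite mule_ge0// lee_fin exponential_pdf_ge0.
apply: eq_integral => x _; rewrite muleCA -muleA -!EFinM; congr (_ * _%:E).
have [x0|x0] := leP 0%R x; last by rewrite !lt0_exponential_pdf// !mulr0.
rewrite !exponential_pdfE// mulrCA -expRD mulrA divfK//.
by congr (_ * expR _)%R; ring.
Qed.

(** Lack of memory, for translations to the right of subsets of the
    half-line. *)
Lemma exp_law_shift r (j : R) A : (0 <= j)%R -> measurable A ->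
    A `<=` [set x | 0 <= x]%R ->
  exp_law r [set i | A (i - j)%R] = (expR (- r%:num * j))%:E * exp_law r A.
Proof.
move=> j0 mA A0.
have mAj : measurable [set i | A (i - j)%R].
  rewrite -[X in measurable X]setTI.
  by apply: measurable_funB => //; exact: mA.
rewrite (exp_law_indic r mA) (exp_law_indic r mAj).
rewrite (ge0_integral_lebesgue_affine j ltr01 (mpdf r mAj) (pdf_ge0 r _)) mul1e.
rewrite -(ge0_integralZl_EFin _ measurableT _ (mpdf r mA)) ?expR_ge0//.
apply: eq_integral => x _; rewrite -EFinM mul1r; congr EFin.
rewrite (_ : \1__ (x + j) = \1_A x :> R)%R; last first.
  by rewrite !indicE; congr (_%:R); rewrite /in_mem/= /in_set/= addrK.
rewrite indicE; have [xA|] := boolP (x \in A); last by rewrite !mul0r mulr0.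
have x0 := A0 _ (set_mem xA).
rewrite !mul1r !exponential_pdfE ?addr_ge0// mulrCA -expRD.
by congr (_ * expR _)%R; ring.
Qed.

(** The absolute value is invisible under the law; it makes the rescaled
    weights of [rescaled_weights] nonnegative at every sample point. *)
Lemma exp_law_scale (r r' : {posnum R}) A : measurable A ->
  exp_law r [set y | A (r%:num / r'%:num * `|y|)%R] = exp_law r' A.
Proof.
move=> mA; set k := (r%:num / r'%:num)%R.
have k0 : (0 < k)%R by rewrite divr_gt0.
have mAk : measurable [set y : R | A (k * `|y|)%R].
  rewrite -[X in measurable X]setTI.
  by apply: measurable_funM => //; exact: normr_measurable.
rewrite (exp_law_indic r mAk) (exp_law_indic r' mA).
rewrite [RHS](ge0_integral_lebesgue_affine 0 k0 (mpdf _ mA) (pdf_ge0 _ _)).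
rewrite -(ge0_integralZl_EFin _ measurableT)//; last 2 first.
- apply: (measurableT_comp (mpdf _ mA)).
  by apply: measurable_funD => //; exact: measurable_funM.
- exact: ltW.
apply: eq_integral => x _; rewrite -EFinM addr0; congr EFin.
have [x0|x0] := leP 0%R x; last first.
  by rewrite !lt0_exponential_pdf ?mulr0// pmulr_rlt0.
rewrite (_ : \1__ x = \1_A (k * x)%R :> R)%R; last first.
  by rewrite !indicE; congr (_%:R); rewrite /in_mem/= /in_set/= ger0_norm.
rewrite !exponential_pdfE ?mulr_ge0 ?(ltW k0)//.
have kE : (r%:num = k * r'%:num)%R by rewrite /k divfK.
rewrite (_ : - r%:num * x = - r'%:num * (k * x))%R; last by rewrite kE; ring.
by rewrite kE; ring.
Qed.

End exponential_law_identities.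

(** * The flip at a corner, for three exponential variables *)

Section corner_split.
Local Open Scope ereal_scope.
Context {R : realType}.
Implicit Types (a b c r : {posnum R}) (A B C S : set R).

Lemma measurable_fun_set d (T : measurableType d) (f : T -> R) A :
  measurable_fun setT f -> measurable A -> measurable [set t | A (f t)].
Proof. by move=> mf mA; rewrite -[X in measurable X]setTI; exact: mf. Qed.

Lemma measurable_corner S A B C :
    measurable S -> measurable A -> measurable B -> measurable C ->
  measurable [set u : R * (R * R) |
    [/\ S (u.2.2 - u.2.1)%R, A (u.1 + (u.2.2 - u.2.1))%R, B u.1 & C u.2.1]].
Proof.
move=> mS mA mB mC.
rewrite (_ : [set u | _] = [set u | S (u.2.2 - u.2.1)%R] `&`
    [set u | A (u.1 + (u.2.2 - u.2.1))%R] `&` [set u | B u.1] `&`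
    [set u | C u.2.1]); last first.
  by apply/seteqP; split=> u /= [] // [] // [].
have m21 : measurable_fun setT (fun u : R * (R * R) => u.2.1).
  exact: measurableT_comp.
have m22 : measurable_fun setT (fun u : R * (R * R) => u.2.2).
  exact: measurableT_comp.
apply: measurableI; last exact: measurable_fun_set.
apply: measurableI; last exact: measurable_fun_set.
apply: measurableI; apply: measurable_fun_set => //.
  exact: measurable_funB.
by apply: measurable_funD => //; exact: measurable_funB.
Qed.

Let xsecE (T1 T2 : Type) (X : set (T1 * T2)) x y : xsection X x y = X (x, y).
Proof. by rewrite /xsection/= in_setE. Qed.

(** One cell of the corner flip. Let X, J, I have rates c = a + b, b, a. Where
    I >= J, the flip sends (I, J, X) to (X + I - J, X, J), and the lemma says
    that the flipped triple has the law of (I, J, X) on this cell. Given J = j,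
    lack of memory of I replaces I - j by a variable of rate a at the price
    exp (- a j), which turns the rate b of j into c; given X = x, the same
    property used backwards replaces X + (I - J) by I at the price exp (a x),
    which turns the rate c of x into b. The factors b / c and c / b of the two
    changes of rate cancel. *)
Lemma exp_law_corner_split a b c S A B C : (a%:num + b%:num = c%:num)%R ->
    measurable S -> S `<=` [set x | 0 <= x]%R ->
    measurable A -> measurable B -> measurable C ->
  (exp_law c \x (exp_law b \x exp_law a))
    [set u | [/\ S (u.2.2 - u.2.1)%R, A (u.1 + (u.2.2 - u.2.1))%R, B u.1 & C u.2.1]] =
  exp_law c C *
  (exp_law b \x exp_law a) [set v | [/\ S (v.2 - v.1)%R, A v.2 & B v.1]].
Proof.
move=> abc mS S0 mA mB mC.
set D := [set u | _]; set E := [set v | _].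
pose F := [set v : R * R | [/\ S v.2, A (v.1 + v.2)%R & B v.1]].
have mE : measurable E.
  rewrite (_ : E = [set v | S (v.2 - v.1)%R] `&` [set v | A v.2] `&` [set v | B v.1]); last first.
    by apply/seteqP; split=> v /= [] // [].
  apply: measurableI; [apply: measurableI|]; apply: measurable_fun_set => //.
  exact: measurable_funB.
have mF : measurable F.
  rewrite (_ : F = [set v | S v.2] `&` [set v | A (v.1 + v.2)%R] `&` [set v | B v.1]); last first.
    by apply/seteqP; split=> v /= [] // [].
  apply: measurableI; [apply: measurableI|]; apply: measurable_fun_set => //.
  exact: measurable_funD.
have mD : measurable D by exact: measurable_corner.
have mC1 : measurable_fun setT (fun j : R => (\1_C j : R)%:E).
  by apply/measurable_EFinP; exact: measurable_indic.
have ind0 (j : R) : 0 <= (\1_C j)%:E :> \bar R by rewrite lee_fin.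
have inner x : (exp_law b \x exp_law a) (xsection D x) =
    (b%:num / c%:num)%:E * exp_law c C * exp_law a (xsection F x).
  have mFx : measurable (xsection F x) by exact: measurable_xsection.
  have -> : exp_law c C = \int[exp_law c]_j (\1_C j)%:E.
    by rewrite integral_indic// setIT.
  rewrite -exp_law_tilt// -ge0_integralZr//; last first.
    apply: (emeasurable_funM mC1); apply/measurable_EFinP.
    by apply: measurableT_comp => //; exact: measurable_funM.
  apply: eq_integral_exp_law.
  - by apply: measurable_fun_xsection; exact: measurable_xsection.
  - apply: emeasurable_funM => //; apply: (emeasurable_funM mC1).
    apply/measurable_EFinP.
    by apply: measurableT_comp => //; exact: measurable_funM.
  - by move=> j; exact: measure_ge0.
  - by move=> j; rewrite !mule_ge0// lee_fin expR_ge0.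
  move=> j j0 /=.
  have -> : (b%:num - c%:num = - a%:num)%R by rewrite -abc; ring.
  rewrite -muleA -exp_law_shift//; last first.
    by move=> i; rewrite xsecE => -[/S0].
  rewrite indicE; have [jC|jC] := boolP (j \in C).
    rewrite mul1e; congr (exp_law a _); apply/seteqP; split=> i.
      by rewrite !xsecE/= xsecE => -[].
    by rewrite !xsecE/= xsecE => -[] *; split => //; exact: set_mem.
  rewrite mul0e (_ : xsection _ _ = set0) ?measure0//.
  apply/seteqP; split=> i //; rewrite !xsecE => -[_ _ _ Cj].
  by move/negP : jC; rewrite inE.
pose psi x := exp_law a (xsection F x).
have mpsi : measurable_fun setT psi by exact: measurable_fun_xsection.
have psi0 x : setT x -> 0 <= psi x by move=> _; exact: measure_ge0.
pose phi x := exp_law a (xsection E x).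
have mphi : measurable_fun setT phi by exact: measurable_fun_xsection.
transitivity (\int[exp_law c]_x ((b%:num / c%:num)%:E * exp_law c C * psi x)).
  by apply: eq_integral => x _; rewrite /= inner.
rewrite (ge0_integralZl _ measurableT mpsi psi0); last by rewrite mule_ge0// lee_fin.
have -> : \int[exp_law c]_x psi x =
    \int[exp_law c]_x (phi x * (expR ((c%:num - b%:num) * x))%:E).
  apply: eq_integral_exp_law.
  - exact: measurable_fun_xsection.
  - apply: emeasurable_funM => //; apply/measurable_EFinP.
    by apply: measurableT_comp => //; exact: measurable_funM.
  - by move=> x; exact: measure_ge0.
  - by move=> x; rewrite mule_ge0 ?measure_ge0// lee_fin expR_ge0.
  move=> x x0.
  have -> : (c%:num - b%:num = a%:num)%R by rewrite -abc; ring.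
  rewrite /psi /phi (_ : xsection E x = [set i | xsection F x (i - x)%R]); last first.
    apply/seteqP; split=> i; rewrite /= !xsecE /F /E/= addrCA subrr addr0 => -[? ? ?]; by split.
  rewrite exp_law_shift//; last 2 first.
  - exact: measurable_xsection.
  - by move=> i; rewrite xsecE => -[/S0].
  by rewrite muleAC -EFinM -expRD mulNr addrC subrr expR0 mul1e.
rewrite exp_law_tilt// muleA; congr (_ * _).
by rewrite muleAC -EFinM mulrA divfK// divff// mul1e.
Qed.
End corner_split.

Section joint_laws.
Local Open Scope ereal_scope.
Context d d1 d2 (T : measurableType d) (T1 : measurableType d1)
  (T2 : measurableType d2) (R : realType).

(** Rectangles determine a joint law. The measure [eta] will be a tilted or
    restricted one, whence the total mass [k]. *)
Lemma pair_law (eta : {measure set T -> \bar R}) (m1 : probability T1 R)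
    (m2 : probability T2 R) (k : R) (f : T -> T1) (g : T -> T2) :
    (0 <= k)%R -> measurable_fun setT f -> measurable_fun setT g ->
    (forall A B, measurable A -> measurable B ->
      eta [set t | A (f t) /\ B (g t)] = k%:E * (m1 A * m2 B)) ->
  forall D, measurable D -> eta [set t | D (f t, g t)] = k%:E * (m1 \x m2) D.
Proof.
move=> k0 mf mg etaE D mD.
have mfg : measurable_fun setT (fun t => (f t, g t)) by exact: measurable_fun_pair.
pose M := [the measure _ _ of pushforward eta (fun t => (f t, g t))].
rewrite -[LHS]/(M mfg D).
rewrite -(@product_measure_unique _ _ _ _ _ (mscale (NngNum k0) m1) m2 (M mfg))//.
  rewrite /product_measure1 ge0_integral_mscale//.
  exact: measurable_fun_xsection.
by move=> A B mA mB; rewrite /= /pushforward/= [LHS](etaE A B)// muleA.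
Qed.

Lemma product_measure_swap (m1 : probability T1 R) (m2 : probability T2 R) D :
  measurable D -> (m1 \x m2) D = (m2 \x m1) [set v | D (v.2, v.1)].
Proof.
move=> mD.
have msw : measurable_fun setT (fun v : T2 * T1 => (v.2, v.1)).
  exact: measurable_fun_pair.
pose M := [the measure _ _ of pushforward (m2 \x m1) (fun v : T2 * T1 => (v.2, v.1))].
apply: (@product_measure_unique _ _ _ _ _ m1 m2 (M msw)) => //.
move=> A B mA mB; rewrite /= /pushforward.
rewrite (_ : _ @^-1` _ = B `*` A); last by apply/seteqP; split=> v [].
by rewrite product_measure1E// muleC.
Qed.

End joint_laws.

Section joint_laws3.
Local Open Scope ereal_scope.
Context d d1 d2 d3 (T : measurableType d) (T1 : measurableType d1)
  (T2 : measurableType d2) (T3 : measurableType d3) (R : realType).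

(** Restricting [eta] to the event that [f] lies in a given set reduces the
    claim to two factors. *)
Lemma triple_law (eta : {measure set T -> \bar R}) (m1 : probability T1 R)
    (m2 : probability T2 R) (m3 : probability T3 R) (k : R)
    (f : T -> T1) (g : T -> T2) (h : T -> T3) :
    (0 <= k)%R ->
    measurable_fun setT f -> measurable_fun setT g -> measurable_fun setT h ->
    (forall A B C, measurable A -> measurable B -> measurable C ->
      eta [set t | [/\ A (f t), B (g t) & C (h t)]] =
      k%:E * (m1 A * (m2 B * m3 C))) ->
  forall D, measurable D ->
    eta [set t | D (f t, (g t, h t))] = k%:E * (m1 \x (m2 \x m3)) D.
Proof.
move=> k0 mf mg mh etaE.
apply: (@pair_law _ _ _ _ _ _ _ eta m1 (m2 \x m3) k f (fun t => (g t, h t))) => //.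
  exact: measurable_fun_pair.
move=> A B mA mB.
have mfA : measurable [set t | A (f t)].
  by rewrite -[X in measurable X]setTI; exact: mf.
have fA : m1 A \is a fin_num by rewrite fin_num_measure.
have kE : (k * fine (m1 A))%:E = k%:E * m1 A by rewrite EFinM fineK.
rewrite muleA -kE -(@pair_law _ _ _ _ _ _ _ (mrestr eta mfA) m2 m3 _ g h)//.
- rewrite /mrestr; congr (eta _); apply/seteqP; split=> t [] //.
- by rewrite mulr_ge0// fine_ge0.
- move=> B' C mB' mC; rewrite kE -muleA -etaE// /mrestr; congr (eta _).
  by apply/seteqP; split=> t; [case=> -[]|case].
Qed.
End joint_laws3.

(** * Families of independent exponential variables *)

Section exp_product.
Local Open Scope ereal_scope.
Context d (T : measurableType d) (R : realType) (I : eqType).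
Implicit Types (nu : {measure set T -> \bar R}) (S : seq I) (X : I -> T -> R)
  (r : I -> {posnum R}) (k : R).

(** Independence with exponential marginals, up to the total mass [k]. Measures
    are tilted below without being normalised, because the masses they acquire
    are the exponential moments that are sought. *)
Definition exp_product nu S X r k := forall B : I -> set R,
  (forall i, measurable (B i)) ->
  nu [set t | forall i, i \in S -> B i (X i t)] =
  k%:E * \prod_(i <- S) exp_law (r i) (B i).

Lemma exp_product_perm nu S S' X r k : perm_eq S S' ->
  exp_product nu S X r k -> exp_product nu S' X r k.
Proof.
move=> SS' H B mB; rewrite -(perm_big _ SS')/= -H//; congr (nu _).
by apply/seteqP; split=> t /= Ht i; have := Ht i; rewrite (perm_mem SS').
Qed.

Lemma eq_exp_product nu S X X' r r' k :
    {in S, forall i, X i = X' i} -> {in S, forall i, r i = r' i} ->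
  exp_product nu S X r k -> exp_product nu S X' r' k.
Proof.
move=> XX' rr' H B mB; rewrite -(@eq_big_seq _ _ _ _ _ (fun i => exp_law (r i) (B i))); last first.
  by move=> i iS; rewrite rr'.
rewrite -H//; congr (nu _).
by apply/seteqP; split=> t /= Ht i iS; have := Ht i iS; rewrite XX'.
Qed.

Lemma prod_exp_law_fin S r (B : I -> set R) : (forall i, measurable (B i)) ->
  \prod_(i <- S) exp_law (r i) (B i) =
  (\prod_(i <- S) fine (exp_law (r i) (B i)))%:E.
Proof.
move=> mB; elim: S => [|i S IH]; first by rewrite !big_nil.
by rewrite !big_cons IH EFinM fineK// fin_num_measure.
Qed.

Lemma measurable_forall_in S X (B : I -> set R) :
    (forall i, measurable (B i)) -> {in S, forall i, measurable_fun setT (X i)} ->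
  measurable [set t | forall i, i \in S -> B i (X i t)].
Proof.
move=> mB; elim: S => [|i S IH] mX.
  by rewrite (_ : [set _ | _] = setT)//; apply/seteqP; split.
rewrite (_ : [set _ | _] = [set t | B i (X i t)] `&`
    [set t | forall i, i \in S -> B i (X i t)]); last first.
  apply/seteqP; split=> t /=.
    move=> H; split; first by apply: H; rewrite mem_head.
    by move=> j jS; apply: H; rewrite in_cons jS orbT.
  by move=> [Bi H] j; rewrite in_cons => /predU1P[->//|/H].
apply: measurableI; first by apply: measurable_fun_set => //; apply: mX; rewrite mem_head.
by apply: IH => j jS; apply: mX; rewrite in_cons jS orbT.
Qed.

End exp_product.

Section tilt.
Local Open Scope ereal_scope.
Context d (T : measurableType d) (R : realType).
Implicit Types (nu : {measure set T -> \bar R}) (g : T -> R).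

Definition exp_tilt nu g (A : set T) : \bar R :=
  \int[nu]_(x in A) (expR (g x))%:E.

Section tilt_measure.
Variables (nu : {measure set T -> \bar R}) (g : T -> R).
Hypothesis mg : measurable_fun setT g.

Let mexpg : measurable_fun setT (fun x => (expR (g x))%:E).
Proof. by apply/measurable_EFinP; exact: measurableT_comp. Qed.

Let exp_tilt0 : exp_tilt nu g set0 = 0.
Proof. exact: integral_set0. Qed.

Let exp_tilt_ge0 A : 0 <= exp_tilt nu g A.
Proof. by apply: integral_ge0 => x _; rewrite lee_fin expR_ge0. Qed.

Let exp_tilt_sigma_additive : semi_sigma_additive (exp_tilt nu g).
Proof.
by apply: semi_sigma_additive_nng_induced => // x; rewrite lee_fin expR_ge0.
Qed.

HB.instance Definition _ := isMeasure.Build _ _ _ (exp_tilt nu g)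
  exp_tilt0 exp_tilt_ge0 exp_tilt_sigma_additive.

Definition tilted : {measure set T -> \bar R} := exp_tilt nu g.

Lemma ge0_integral_tilted (f : T -> \bar R) :
    measurable_fun setT f -> (forall x, 0 <= f x) ->
  \int[tilted]_x f x = \int[nu]_x (f x * (expR (g x))%:E).
Proof.
by apply: ge0_integral_density => //; exact: measurableT_comp.
Qed.

End tilt_measure.

Lemma ge0_integral_mrestr nu (E A : set T) (mE : measurable E) (f : T -> \bar R) :
    measurable A -> measurable_fun setT f -> (forall x, 0 <= f x) ->
  \int[mrestr nu mE]_(x in A) f x = \int[nu]_(x in A `&` E) f x.
Proof.
move=> mA mf f0.
have mfA : measurable_fun setT (f \_ A).
  by apply/(measurable_restrictT _ mA); exact: measurable_funTS.
have fA0 x : 0 <= (f \_ A) x by rewrite patchE; case: ifP.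
have rE B : measurable B -> mrestr nu mE B = \int[nu]_(x in B) (\1_E x)%:E.
  by move=> mB; rewrite /mrestr integral_indic// setIC.
have E0 x : (0 <= \1_E x :> R)%R by [].
rewrite [LHS]integral_mkcond.
rewrite [LHS](ge0_integral_density (measurable_indic mE) E0 rE mfA fA0).
rewrite [RHS]integral_mkcond; apply: eq_integral => x _.
by rewrite setIC patch_setI (epatch_indic (f \_ A)).
Qed.

(** The density depends on one variable only, so by independence the other
    factors are unchanged, and for that variable this is [exp_law_tilt]. *)
Lemma exp_product_tilt (I : eqType) nu (p : I) (S : seq I) (X : I -> T -> R)
    (r r' : I -> {posnum R}) (k : R) (g : T -> R) (mg : measurable_fun setT g) :
    (0 <= k)%R -> p \notin S -> {in p :: S, forall i, measurable_fun setT (X i)} ->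
    (forall t, g t = ((r p)%:num - (r' p)%:num) * X p t)%R ->
    {in S, forall i, r' i = r i} ->
  exp_product nu (p :: S) X r k ->
  exp_product (tilted nu mg) (p :: S) X r' (k * ((r p)%:num / (r' p)%:num)).
Proof.
move=> k0 pS mX gE rS H B mB.
have mXp : measurable_fun setT (X p) by apply: mX; rewrite mem_head.
pose E := [set t | forall i, i \in S -> B i (X i t)].
have mE : measurable E.
  by apply: measurable_forall_in => // i iS; apply: mX; rewrite in_cons iS orbT.
pose K := (k * \prod_(i <- S) fine (exp_law (r i) (B i)))%R.
have K0 : (0 <= K)%R.
  by apply: mulr_ge0 => //; apply: prodr_ge0 => i _; rewrite fine_ge0.
pose M := [the measure _ _ of pushforward (mrestr nu mE) (X p)].
have Bp A i : i \in S -> (if i == p then A else B i) = B i.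
  by case: eqP => // -> ; rewrite (negbTE pS).
have ME A : measurable A -> M mXp A = mscale (NngNum K0) (exp_law (r p)) A.
  move=> mA; have := H (fun i => if i == p then A else B i).
  rewrite big_cons eqxx (eq_big_seq (fun i => exp_law (r i) (B i))); last first.
    by move=> i iS; rewrite Bp.
  rewrite prod_exp_law_fin// => H'.
  rewrite /= /pushforward /mrestr /mscale/= EFinM muleAC -muleA -H'; last first.
    by move=> i; case: ifP.
  congr (nu _); apply/seteqP; split=> t /=.
    move=> [At Et] i; rewrite in_cons => /predU1P[->|iS]; first by rewrite eqxx.
    by rewrite Bp//; exact: Et.
  move=> Ht; split; first by have := Ht p (mem_head _ _); rewrite eqxx.
  by move=> i iS; rewrite -(Bp A)//; apply: Ht; rewrite in_cons iS orbT.
rewrite (_ : [set t | _] = X p @^-1` (B p) `&` E); last first.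
  apply/seteqP; split=> t /=.
    move=> Ht; split; first by apply: Ht; rewrite mem_head.
    by move=> i iS; apply: Ht; rewrite in_cons iS orbT.
  by move=> [Bpt Et] i; rewrite in_cons => /predU1P[->//|]; exact: Et.
pose h y := (expR (((r p)%:num - (r' p)%:num) * y))%:E.
have mh : measurable_fun setT h.
  by apply/measurable_EFinP; apply: measurableT_comp => //; exact: measurable_funM.
have h0 y : 0 <= h y by rewrite lee_fin expR_ge0.
rewrite /tilted/= /exp_tilt.
rewrite (eq_integral (h \o X p)); last by move=> t _; rewrite gE.
rewrite -(ge0_integral_mrestr nu mE (measurable_fun_set mXp (mB p))
  (measurableT_comp mh mXp) (fun t => h0 (X p t))).
rewrite -(ge0_integral_pushforward mXp (mrestr nu mE) (mB p) (measurable_funTS mh) (fun y _ => h0 y)).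
rewrite (@eq_measure_integral _ _ _ _ (mscale (NngNum K0) (exp_law (r p)))); last first.
  by move=> A mA _; exact: ME.
rewrite ge0_integral_mscale//; last exact: measurable_funTS.
rewrite integral_mkcond (eq_integral (fun y => (\1_(B p) y)%:E * h y)); last first.
  by move=> y _; rewrite epatch_indic muleC.
rewrite exp_law_tilt//; last by apply/measurable_EFinP; exact: measurable_indic.
rewrite integral_indic// setIT big_cons.
rewrite (@eq_big_seq _ _ _ _ _ (fun i => exp_law (r' i) (B i)) (fun i => exp_law (r i) (B i))); last first.
  by move=> i iS; rewrite rS.
rewrite prod_exp_law_fin//= /K !EFinM -!muleA; congr (_ * _).
by rewrite muleC -!muleA.
Qed.

End tilt.

Section corner_flip.
Local Open Scope ereal_scope.
Context d (T : measurableType d) (R : realType) (I : eqType).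

Let mule_321 (k a b c : \bar R) : k * (a * (b * c)) = k * (c * (b * a)).
Proof. by rewrite (muleC a) (muleC b c) -(muleA c). Qed.

Let mule_312 (k a b c : \bar R) : k * (a * (b * c)) = k * (c * (a * b)).
Proof. by rewrite (muleA a b c) (muleC (a * b)). Qed.

(** The two cells of the corner flip exhaust the plane, ties going to the
    first. *)
Lemma product_order_split (m1 m2 : probability R R) (A B : set R) :
    measurable A -> measurable B ->
  (m2 \x m1) [set v | [/\ [set y | 0 <= y]%R (v.2 - v.1)%R, A v.2 & B v.1]] +
  (m1 \x m2) [set v | [/\ [set y | 0 < y]%R (v.2 - v.1)%R, B v.2 & A v.1]] =
  m1 A * m2 B.
Proof.
move=> mA mB.
have mge : measurable [set y : R | 0 <= y]%R by rewrite -set_itvcy.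
have mgt : measurable [set y : R | 0 < y]%R by rewrite -set_itvoy.
have mE (S A' B' : set R) : measurable S -> measurable A' -> measurable B' ->
    measurable [set v : R * R | [/\ S (v.2 - v.1)%R, A' v.2 & B' v.1]].
  move=> mS mA' mB'.
  rewrite (_ : [set v | _] =
    [set v | S (v.2 - v.1)%R] `&` [set v | A' v.2] `&` [set v | B' v.1]); last first.
    by apply/seteqP; split=> v /= [] // [].
  apply: measurableI; [apply: measurableI|]; apply: measurable_fun_set => //.
  exact: measurable_funB.
rewrite (product_measure_swap m1 m2 (mE _ _ _ mgt mB mA)).
rewrite muleC -product_measure1E// -measureU//; last 3 first.
- exact: mE.
- have := mE [set y | y < 0]%R A B _ mA mB.
  rewrite -set_itvNyo => /(_ (measurable_itv _)).
  rewrite (_ : mkset _ = [set v | [set v0 | [/\ [set y | 0 < y] (v0.2 - v0.1), B v0.2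
    & A v0.1]]%R (v.2, v.1)])//.
  apply/seteqP; split=> v /=; rewrite in_itv/= => -[? ? ?]; split => //.
    by rewrite subr_gt0 -subr_lt0.
  by rewrite subr_lt0 -subr_gt0.
- apply/seteqP; split=> v // -[[/= + _ _] [/= + _ _]].
  by rewrite subr_ge0 subr_gt0 => /le_lt_trans/[apply]; rewrite ltxx.
congr (product_measure1 _ _ _); apply/seteqP; split=> v /=.
  by move=> [[]|[]].
move=> [Bv Av]; rewrite subr_ge0 subr_gt0.
by case: (leP v.1 v.2) => le; [left|right].
Qed.

Let collect (k u1 u2 a b l P : \bar R) (K' : R) : (0 <= K')%R -> K'%:E = k * P ->
  0 <= u1 -> 0 <= u2 -> u1 + u2 = a * b ->
  K'%:E * (l * u1) + K'%:E * (l * u2) = k * (a * (b * (l * P))).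
Proof.
move=> K0 KE u10 u20 u12.
rewrite !(muleA K'%:E l) -ge0_muleDr// u12 KE.
by rewrite (muleA a) (muleC _ (l * P)) (muleC l P) !muleA.
Qed.

(** Burke's property at one corner. The increments [X p], [X q] along two sides
    of a unit square and the weight [X x] at its far corner determine the
    increments along the opposite sides; together with the minimum of the old
    increments these have the same joint law, provided that the rates of the
    increments add up to that of the weight. The variables indexed by [S] are
    untouched: they enter by restricting [nu] to the event they prescribe. *)
Lemma exp_product_flip (nu : {measure set T -> \bar R}) (p q x : I) (S : seq I)
    (X X' : I -> T -> R) (r : I -> {posnum R}) (k : R) :
    (0 <= k)%R -> uniq [:: p, q, x & S] ->
    {in [:: p, q, x & S], forall i, measurable_fun setT (X i)} ->
    ((r p)%:num + (r q)%:num = (r x)%:num)%R ->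
    (forall t, X' p t = X x t + Num.max (X p t - X q t) 0)%R ->
    (forall t, X' q t = X x t + Num.max (X q t - X p t) 0)%R ->
    (forall t, X' x t = Num.min (X p t) (X q t)) ->
    {in S, forall i, X' i = X i} ->
  exp_product nu [:: p, q, x & S] X r k -> exp_product nu [:: p, q, x & S] X' r k.
Proof.
move=> k0 uS mX rpqx X'p X'q X'x X'S H B mB.
move: (uS); rewrite /= !inE !negb_or.
move=> /and4P[/and3P[pq px pS] /andP[qx qS] xS _].
have mXp : measurable_fun setT (X p) by apply: mX; rewrite !inE eqxx.
have mXq : measurable_fun setT (X q) by apply: mX; rewrite !inE eqxx orbT.
have mXx : measurable_fun setT (X x) by apply: mX; rewrite !inE eqxx !orbT.
pose E := [set t | forall i, i \in S -> B i (X i t)].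
have mE : measurable E.
  by apply: measurable_forall_in => // i iS; apply: mX; rewrite !in_cons iS !orbT.
have [K K0 KE] : exists2 K : R, (0 <= K)%R &
    K%:E = k%:E * \prod_(i <- S) exp_law (r i) (B i).
  exists (k * \prod_(i <- S) fine (exp_law (r i) (B i)))%R.
    by apply: mulr_ge0 => //; apply: prodr_ge0 => i _; rewrite fine_ge0.
  by rewrite prod_exp_law_fin.
have HE A1 A2 A3 : measurable A1 -> measurable A2 -> measurable A3 ->
    mrestr nu mE [set t | [/\ A1 (X p t), A2 (X q t) & A3 (X x t)]] =
    K%:E * (exp_law (r p) A1 * (exp_law (r q) A2 * exp_law (r x) A3)).
  move=> mA1 mA2 mA3.
  pose B' i := if i == p then A1 else if i == q then A2 else if i == x then A3 else B i.
  have B'p : B' p = A1 by rewrite /B' eqxx.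
  have B'q : B' q = A2 by rewrite /B' eq_sym (negbTE pq) eqxx.
  have B'x : B' x = A3 by rewrite /B' eq_sym (negbTE px) eq_sym (negbTE qx) eqxx.
  have B'S i : i \in S -> B' i = B i.
    by move=> iS; rewrite /B'; do 3 ![case: eqP => [iE|_];
      first by move: pS qS xS; rewrite -iE iS].
  have := H B'; rewrite !big_cons B'p B'q B'x.
  rewrite (eq_big_seq (fun i => exp_law (r i) (B i))); last first.
    by move=> i iS; rewrite B'S.
  move=> H'; rewrite KE muleAC -muleA -!(muleA (exp_law _ _)) -H'; last first.
    by move=> i; rewrite /B'; do 3 ![case: ifP => // _].
  rewrite /mrestr; congr (nu _); apply/seteqP; split=> t /=.
    move=> [[At1 At2 At3] Et] i; rewrite !in_cons.
    move=> /predU1P[->|/predU1P[->|/predU1P[->|iS]]]; rewrite ?B'p ?B'q ?B'x ?B'S//.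
    exact: Et.
  move=> Ht; split.
    by split; [have := Ht p|have := Ht q|have := Ht x];
      rewrite ?B'p ?B'q ?B'x !in_cons !eqxx ?orbT; apply.
  by move=> i iS; rewrite -(B'S i)//; apply: Ht; rewrite !in_cons iS !orbT.
(* [D1] and [D2] prescribe the flipped values on the cells where [X p],
   respectively [X q], is the larger increment; the coordinates are the weight,
   the smaller and the larger increment. *)
pose D1 := [set u : R * (R * R) | [/\ [set y | 0 <= y]%R (u.2.2 - u.2.1)%R,
  B p (u.1 + (u.2.2 - u.2.1))%R, B q u.1 & B x u.2.1]].
pose D2 := [set u : R * (R * R) | [/\ [set y | 0 < y]%R (u.2.2 - u.2.1)%R,
  B q (u.1 + (u.2.2 - u.2.1))%R, B p u.1 & B x u.2.1]].
have mge : measurable [set y : R | 0 <= y]%R by rewrite -set_itvcy.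
have mgt : measurable [set y : R | 0 < y]%R by rewrite -set_itvoy.
have mD1 : measurable D1 by exact: measurable_corner.
have mD2 : measurable D2 by exact: measurable_corner.
have L1 := @exp_law_corner_split R (r p) (r q) (r x) [set y | 0 <= y]%R
  (B p) (B q) (B x) rpqx mge (fun _ => id) (mB p) (mB q) (mB x).
rewrite addrC in rpqx.
have L2 := @exp_law_corner_split R (r q) (r p) (r x) [set y | 0 < y]%R
  (B q) (B p) (B x) rpqx mgt (fun _ => @ltW _ _ _ _) (mB q) (mB p) (mB x).
have T1 : mrestr nu mE [set t | D1 (X x t, (X q t, X p t))] =
    K%:E * (exp_law (r x) \x (exp_law (r q) \x exp_law (r p))) D1.
  apply: (@triple_law _ _ _ _ T R R R R (mrestr nu mE) (exp_law (r x))
    (exp_law (r q)) (exp_law (r p)) K (X x) (X q) (X p) K0 mXx mXq mXp _ D1 mD1).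
  move=> A1 A2 A3 mA1 mA2 mA3.
  rewrite (_ : [set t | _] = [set t | [/\ A3 (X p t), A2 (X q t) & A1 (X x t)]]); last first.
    by apply/seteqP; split=> t [].
  exact: (etrans (HE A3 A2 A1 mA3 mA2 mA1) (mule_321 _ _ _ _)).
have T2 : mrestr nu mE [set t | D2 (X x t, (X p t, X q t))] =
    K%:E * (exp_law (r x) \x (exp_law (r p) \x exp_law (r q))) D2.
  apply: (@triple_law _ _ _ _ T R R R R (mrestr nu mE) (exp_law (r x))
    (exp_law (r p)) (exp_law (r q)) K (X x) (X p) (X q) K0 mXx mXp mXq _ D2 mD2).
  move=> A1 A2 A3 mA1 mA2 mA3.
  rewrite (_ : [set t | _] = [set t | [/\ A2 (X p t), A3 (X q t) & A1 (X x t)]]); last first.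
    by apply/seteqP; split=> t [].
  exact: (etrans (HE A2 A3 A1 mA2 mA3 mA1) (mule_312 _ _ _ _)).
have -> : nu [set t | forall i, i \in [:: p, q, x & S] -> B i (X' i t)] =
    mrestr nu mE ([set t | D1 (X x t, (X q t, X p t))] `|`
                  [set t | D2 (X x t, (X p t, X q t))]).
  rewrite /mrestr; congr (nu _); apply/seteqP; split=> t /=.
    move=> Ht; split; last first.
      by move=> i iS; rewrite -X'S//; apply: Ht; rewrite !in_cons iS !orbT.
    have Bp := Ht p; have Bq := Ht q; have Bx := Ht x; move: Bp Bq Bx.
    rewrite !in_cons !eqxx !orbT X'p X'q X'x => /(_ isT) + /(_ isT) + /(_ isT).
    have [le|lt] := leP (X q t) (X p t).
      rewrite (max_l (_ : 0 <= _)%R) ?subr_ge0// (max_r (_ : _ <= 0)%R) ?subr_le0//.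
      by rewrite addr0 => *; left; split; rewrite //= subr_ge0.
    rewrite (max_r (_ : _ <= 0)%R) ?subr_le0 ?(ltW lt)//.
    rewrite (max_l (_ : 0 <= _)%R) ?subr_ge0 ?(ltW lt)//.
    by rewrite addr0 => *; right; split; rewrite //= subr_gt0.
  move=> [H12 Et] i; rewrite !in_cons.
  move=> /predU1P[->|/predU1P[->|/predU1P[->|iS]]]; last first.
  - by rewrite X'S//; exact: Et.
  - rewrite X'x; case: H12 => -[/=].
      by rewrite subr_ge0 => le _ _; rewrite min_r.
    by rewrite subr_gt0 => /ltW le _ _; rewrite min_l.
  - rewrite X'q; case: H12 => -[/=].
      by rewrite subr_ge0 => le _ + _; rewrite (max_r (_ : _ <= 0)%R) ?subr_le0// addr0.
    by rewrite subr_gt0 => /ltW le + _ _; rewrite (max_l (_ : 0 <= _)%R) ?subr_ge0.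
  - rewrite X'p; case: H12 => -[/=].
      by rewrite subr_ge0 => le + _ _; rewrite (max_l (_ : 0 <= _)%R) ?subr_ge0.
    by rewrite subr_gt0 => /ltW le _ + _; rewrite (max_r (_ : _ <= 0)%R) ?subr_le0// addr0.
rewrite measureU; last 3 first.
- rewrite -[X in measurable X]setTI.
  have : measurable_fun setT (fun t => (X x t, (X q t, X p t))).
    by do 2! [apply: measurable_fun_pair => //].
  exact.
- rewrite -[X in measurable X]setTI.
  have : measurable_fun setT (fun t => (X x t, (X p t, X q t))).
    by do 2! [apply: measurable_fun_pair => //].
  exact.
- apply/seteqP; split=> t // -[[/= + _ _ _] [/= + _ _ _]].
  by rewrite subr_ge0 subr_gt0 => /le_lt_trans/[apply]; rewrite ltxx.
have T1' := etrans T1 (congr1 (fun y => K%:E * y) L1).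
have T2' := etrans T2 (congr1 (fun y => K%:E * y) L2).
rewrite !big_cons.
apply: (etrans (congr2 adde T1' T2')).
exact: (@collect _ _ _ _ _ _ _ _ K0 KE (measure_ge0 (exp_law (r q) \x exp_law (r p)) _) (measure_ge0 (exp_law (r p) \x exp_law (r q)) _)  (product_order_split (exp_law (r p)) (exp_law (r q)) (mB p) (mB q))).
Qed.

End corner_flip.

(** * Burke's property of last-passage percolation *)

Section stationarity.
Context d (T : measurableType d) (R : realType).
Variables (m n : nat) (w : nat * nat -> T -> R).
Hypothesis mw : forall v, measurable_fun setT (w v).

(** The origin is left out because its weight is not random. *)
Definition grid : seq (nat * nat) :=
  [seq v <- [seq (i, j) | i <- iota 0 m.+1, j <- iota 0 n.+1] | v != (0, 0)%N].

Lemma mem_grid v : (v \in grid) = [&& v != (0, 0)%N, (v.1 <= m)%N & (v.2 <= n)%N].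
Proof.
rewrite mem_filter; congr (_ && _); apply/allpairsP/andP.
  by move=> [u [+ + ->]]; rewrite !mem_iota !add0n !ltnS.
by move=> [vm vn]; exists v; rewrite !mem_iota !add0n !ltnS; split => //; case: v {vm vn}.
Qed.

Lemma grid_uniq : uniq grid.
Proof.
apply: filter_uniq; apply: allpairs_uniq; rewrite ?iota_uniq//.
by move=> [? ?] [? ?].
Qed.

Definition boundary_rate (a b c : {posnum R}) (v : nat * nat) : {posnum R} :=
  if v.2 == 0%N then a else if v.1 == 0%N then b else c.

Let L i j t := lpp (w ^~ t) i j.

Lemma measurable_lpp i j : measurable_fun setT (L i j).
Proof.
elim: i j => [|i IHi]; elim=> [|j IHj].
- exact: mw.
- exact: (measurable_funD IHj (mw _)).
- exact: (measurable_funD (IHi _) (mw _)).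
- exact: (measurable_funD (measurable_maxr (IHi _) IHj) (mw _)).
Qed.

(** The unit squares are flipped row by row from the bottom, each row from left
    to right. Once the square with upper right corner (i, j) is done, the
    current down-right path comes from the vertical axis at height j, descends
    to height j - 1 at column i and to the horizontal axis at column m. The
    family [front i j] consists of the increments of the passage time along
    this path, the minima produced by the flips below it, and the original
    weights above it. An increment is stored at the axis point of its row or
    column, so that all these families have the index set [grid] and the same
    rates. *)
Let row_level i j k := if (k <= i)%N then j else j.-1.
Let column_level i j l := if (l < j)%N then m else if l == j then i else 0%N.

Let front i j (v : nat * nat) t : R :=
  if v.2 == 0%N then L v.1 (row_level i j v.1) t - L v.1.-1 (row_level i j v.1) t
  else if v.1 == 0%N then
    L (column_level i j v.2) v.2 t - L (column_level i j v.2) v.2.-1 t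
  else if (v.1 <= column_level i j v.2)%N then
    Num.min (L v.1 v.2.-1 t - L v.1.-1 v.2.-1 t) (L v.1.-1 v.2 t - L v.1.-1 v.2.-1 t)
  else w v t.

Let measurable_front i j v : measurable_fun setT (front i j v).
Proof.
rewrite /front; case: (v.2 == 0%N).
  by apply: measurable_funB; exact: measurable_lpp.
case: (v.1 == 0%N); first by apply: measurable_funB; exact: measurable_lpp.
case: (v.1 <= column_level i j v.2)%N; last exact: mw.
by apply: measurable_minr; apply: measurable_funB; exact: measurable_lpp.
Qed.

Let front01 : {in grid, front 0 1 =1 w}.
Proof.
move=> [k l]; rewrite mem_grid/= => /and3P[kl _ _]; apply/funext => t.
rewrite /front /row_level /column_level /L/=.
case: l kl => [|l]; case: k => [|k]//= _.
- by rewrite addrC addKr.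
- by rewrite if_same lpp0S addrC addKr.
- by rewrite if_same.
Qed.

Let front_next_row j : {in grid, front m j =1 front 0 j.+1}.
Proof.
move=> [k l]; rewrite mem_grid/= => /and3P[kl km ln]; apply/funext => t.
have colE : column_level m j l = column_level 0 j.+1 l.
  by rewrite /column_level ltnS if_same (leq_eqVlt l j); case: ltngtP.
rewrite /front/= colE /row_level km; case: eqP => // l0.
by case: k kl km => [|k]//; rewrite l0.
Qed.

Variable nu : {measure set T -> \bar R}.
Variables (a b c : {posnum R}) (k : R).
Hypotheses (abc : a%:num + b%:num = c%:num) (k0 : 0 <= k).

Let front_step i j : (i < m)%N -> (j < n)%N ->
  exp_product nu grid (front i j.+1) (boundary_rate a b c) k ->
  exp_product nu grid (front i.+1 j.+1) (boundary_rate a b c) k.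
Proof.
move=> im jn H.
pose p := (i.+1, 0)%N; pose q := (0, j.+1)%N; pose x := (i.+1, j.+1).
have [S gS] : exists S, perm_eq grid [:: p, q, x & S].
  exists (rem x (rem q (rem p grid))).
  have pg : p \in grid by rewrite mem_grid xpair_eqE/= im.
  have qg : q \in rem p grid by rewrite mem_rem_uniq ?grid_uniq// inE mem_grid.
  have xg : x \in rem q (rem p grid).
    rewrite mem_rem_uniq ?rem_uniq ?grid_uniq// inE.
    by rewrite mem_rem_uniq ?grid_uniq// inE mem_grid/= im jn !xpair_eqE/= andbF.
  apply: (perm_trans (perm_to_rem pg)); rewrite perm_cons.
  apply: (perm_trans (perm_to_rem qg)); rewrite perm_cons.
  exact: perm_to_rem.
have uS : uniq [:: p, q, x & S] by rewrite -(perm_uniq gS) grid_uniq.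
have Lx t : L i.+1 j.+1 t = Num.max (L i j.+1 t) (L i.+1 j t) + w x t.
  exact: lppSS.
have Fp t : front i j.+1 p t = L i.+1 j t - L i j t.
  by rewrite /front /row_level/= ltnn.
have Fq t : front i j.+1 q t = L i j.+1 t - L i j t.
  by rewrite /front /column_level/= ltnn eqxx.
have Fx t : front i j.+1 x t = w x t.
  by rewrite /front /column_level/= ltnn eqxx ltnn.
apply: (@exp_product_perm _ _ _ _ _ [:: p, q, x & S]); first by rewrite perm_sym.
apply: (exp_product_flip k0 uS (X := front i j.+1)).
- by move=> v _; exact: measurable_front.
- by rewrite /boundary_rate/= abc.
- move=> t; rewrite Fp Fq Fx /front /row_level/= leqnn Lx.
  by case: leP => ?; case: leP => ?; lra.
- move=> t; rewrite Fp Fq Fx /front /column_level/= ltnn eqxx Lx.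
  by case: leP => ?; case: leP => ?; lra.
- by move=> t; rewrite Fp Fq /front /column_level/= ltnn eqxx leqnn.
- move=> [u v] uvS; apply/funext => t.
  have [] : (u, v) != p /\ (u, v) != x.
    move: uS; rewrite /= !in_cons !negb_or.
    move=> /andP[/and3P[_ _ pS]] /andP[_ /andP[xS _]].
    by split; apply/eqP => uvE; [move: pS|move: xS]; rewrite -uvE uvS.
  have : (u, v) != q.
    move: uS; rewrite /= !in_cons !negb_or => /andP[_] /andP[/andP[_ qS] _].
    by apply/eqP => uvE; move: qS; rewrite -uvE uvS.
  rewrite !xpair_eqE => uvq uvp uvx.
  rewrite /front/= /row_level /column_level.
  have [v0|_] := eqVneq v 0%N.
    move: uvp; rewrite v0 andbT => ui.
    by rewrite [in LHS](leq_eqVlt u) (negbTE ui) ltnS.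
  have [vj|//] := eqVneq v j.+1; move: uvq uvx; rewrite vj !eqxx !andbT ltnn.
  move=> u0 ui; rewrite (negbTE u0).
  by rewrite [in LHS](leq_eqVlt u) (negbTE ui) ltnS.
- exact: exp_product_perm gS H.
Qed.

(** When all squares have been flipped, the family stored at the points of the
    vertical axis consists of the increments along the right side of the
    rectangle. *)
Lemma burke : exp_product nu grid w (boundary_rate a b c) k ->
  exists X : nat * nat -> T -> R, [/\ forall v, measurable_fun setT (X v),
    forall l t, (l < n)%N -> X (0, l.+1)%N t = lpp (w ^~ t) m l.+1 - lpp (w ^~ t) m l &
    exp_product nu grid X (boundary_rate a b c) k].
Proof.
move=> H.
have H0 : exp_product nu grid (front 0 1) (boundary_rate a b c) k.
  by apply: eq_exp_product H => // v vS; rewrite front01.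
have row j i : (j < n)%N -> (i <= m)%N ->
    exp_product nu grid (front 0 j.+1) (boundary_rate a b c) k ->
    exp_product nu grid (front i j.+1) (boundary_rate a b c) k.
  move=> jn; elim: i => [//|i IH] im Hj; apply: front_step => //.
  by apply: IH => //; exact: ltnW.
have rows j : (j <= n)%N ->
    exp_product nu grid (front 0 j.+1) (boundary_rate a b c) k.
  elim: j => [//|j IH] jn.
  have := row j m jn (leqnn _) (IH (ltnW jn)).
  by apply: eq_exp_product => // v vS; rewrite front_next_row.
exists (front 0 n.+1); split; [exact: measurable_front| |exact: rows].
by move=> l t ln; rewrite /front/= /column_level ltnS ln.
Qed.

End stationarity.

(** * The exponential moment of the passage time *)

Section mgf.
Local Open Scope ereal_scope.

(** A tilt by [th] times a sum of independent variables is a succession of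
    tilts by the single ones. *)
Lemma exp_product_tilts d (T : measurableType d) (R : realType) (I : eqType)
    (nu : {measure set T -> \bar R}) (S ps : seq I) (X : I -> T -> R)
    (r r' : I -> {posnum R}) (k th : R) :
    (0 <= k)%R -> uniq S -> uniq ps -> {subset ps <= S} ->
    (forall i, measurable_fun setT (X i)) ->
    {in ps, forall i, (r i)%:num - (r' i)%:num = th}%R ->
    {in [predC ps], forall i, r' i = r i} ->
    exp_product nu S X r k ->
  exists2 nu' : {measure set T -> \bar R},
    exp_product nu' S X r' (k * \prod_(i <- ps) ((r i)%:num / (r' i)%:num)) &
    forall f : T -> \bar R, measurable_fun setT f -> (forall t, 0 <= f t) ->
      \int[nu']_t f t = \int[nu]_t (f t * (expR (th * \sum_(i <- ps) X i t))%:E).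
Proof.
move=> k0 uS + psS mX; elim: ps psS r' => [_|p ps IH psS] r' + + rr' H.
  move=> _ _; exists nu.
    rewrite big_nil mulr1; apply: eq_exp_product H => // i _.
    by rewrite rr'.
  move=> f mf f0; apply: eq_integral => t _.
  by rewrite big_nil mulr0 expR0 mule1.
move=> /andP[pps ups] rth.
pose r1 i := if i == p then r p else r' i.
have [||||nu1 H1 int1] := IH _ r1 ups.
- by move=> i ips; apply: psS; rewrite in_cons ips orbT.
- move=> i ips; rewrite /r1; case: eqP => [ip|_]; first by move: pps; rewrite -ip ips.
  by apply: rth; rewrite in_cons ips orbT.
- move=> i; rewrite inE => ips; rewrite /r1; case: eqP => [->//|/eqP ip].
  by rewrite rr'// inE in_cons negb_or ip.
- exact: H.
have pS : p \in S by apply: psS; rewrite mem_head.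
have mg : measurable_fun setT (fun t => th * X p t)%R by exact: measurable_funM.
exists (tilted nu1 mg).
  have SE := perm_to_rem pS.
  apply: (exp_product_perm (S := p :: rem p S)); first by rewrite perm_sym.
  rewrite big_cons (mulrC (_ / _)%R) mulrA.
  have -> : (\prod_(j <- ps) ((r j)%:num / (r' j)%:num) =
      \prod_(j <- ps) ((r j)%:num / (r1 j)%:num))%R.
    apply: eq_big_seq => j jps; rewrite /r1; case: eqP => // jp.
    by move: pps; rewrite -jp jps.
  have -> : r p = r1 p by rewrite /r1 eqxx.
  apply: exp_product_tilt (exp_product_perm SE H1) => //.
  - apply: mulr_ge0 => //; apply: prodr_ge0 => j _; exact: divr_ge0.
  - by rewrite mem_rem_uniqF.
  - by move=> t; rewrite /r1 eqxx rth// mem_head.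
  - move=> i; rewrite mem_rem_uniq// inE => /andP[/negbTE ip _].
    by rewrite /r1 ip.
move=> f mf f0; rewrite (ge0_integral_tilted _ mg mf f0) int1; last first.
- by move=> t; rewrite mule_ge0// lee_fin expR_ge0.
- apply: emeasurable_funM => //; apply/measurable_EFinP.
  exact: measurableT_comp.
apply: eq_integral => t _; rewrite big_cons -muleA -EFinM -expRD -mulrDr.
by [].
Qed.

End mgf.

Section mgf_identity.
Local Open Scope ereal_scope.

Lemma sum_row0_lpp (R : realType) (w : nat * nat -> R) m : w (0, 0)%N = 0%R ->
  (\sum_(p <- [seq (i.+1, 0%N) | i <- iota 0 m]) w p = lpp w m 0)%R.
Proof.
move=> w0; elim: m => [|m IH]; first by rewrite big_nil.
by rewrite -addn1 iotaD map_cat big_cat/= big_seq1 IH addn1 lppS0.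
Qed.

(** The passage time is the sum of the axis weights along the lower side and of
    the increments along the right side. Tilting the former by [th] makes the
    model stationary, so that the latter become independent; tilting these as
    well leaves a measure whose total mass is the exponential moment. *)
Lemma lpp_mgf d (T : measurableType d) (R : realType)
    (P : {measure set T -> \bar R}) (m n : nat) (w : nat * nat -> T -> R)
    (a b c : {posnum R}) :
    (a%:num < c%:num)%R -> (b%:num < c%:num)%R ->
    (forall v, measurable_fun setT (w v)) -> (forall t, w (0, 0)%N t = 0)%R ->
    exp_product P (grid m n) w (boundary_rate a b c) 1 ->
  \int[P]_t (expR ((a%:num + b%:num - c%:num) * lpp (w ^~ t) m n))%:E =
  ((a%:num / (c%:num - b%:num)) ^+ m * (b%:num / (c%:num - a%:num)) ^+ n)%:E.
Proof.
move=> ac bc mw w0 H; set th := (a%:num + b%:num - c%:num)%R.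
have a'0 : (0 < c%:num - b%:num)%R by rewrite subr_gt0.
have b'0 : (0 < c%:num - a%:num)%R by rewrite subr_gt0.
pose a' : {posnum R} := PosNum a'0; pose b' : {posnum R} := PosNum b'0.
pose hs := [seq (i.+1, 0)%N | i <- iota 0 m].
pose vs := [seq (0, j.+1)%N | j <- iota 0 n].
have uhs : uniq hs by rewrite map_inj_uniq ?iota_uniq// => i j [].
have uvs : uniq vs by rewrite map_inj_uniq ?iota_uniq// => i j [].
have hsS : {subset hs <= grid m n}.
  by move=> v /mapP[i]; rewrite mem_iota add0n => /andP[_ im] ->; rewrite mem_grid/= im.
have vsS : {subset vs <= grid m n}.
  by move=> v /mapP[i]; rewrite mem_iota add0n => /andP[_ im] ->; rewrite mem_grid/= im.
have mem_hs v : v \in grid m n -> (v \in hs) = (v.2 == 0%N).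
  move=> vg; apply/mapP/eqP => [[i _ ->]//|v2].
  move: vg; case: v v2 => -[|i] j /= ->; rewrite mem_grid/= => // im.
  by exists i => //; rewrite mem_iota add0n; case/andP: im.
have mem_vs v : v \in grid m n -> (v \in vs) = (v.1 == 0%N).
  move=> vg; apply/mapP/eqP => [[i _ ->]//|v2].
  move: vg; case: v v2 => i -[|j] /= ->; rewrite mem_grid/= => // im.
  by exists j => //; rewrite mem_iota add0n.
pose tiltr (S : seq (nat * nat)) (s s' : {posnum R}) (r : nat * nat -> {posnum R}) v :=
  if v \in S then s' else r v.
(* Since a - th = c - b, this tilt makes the rates of the axes add up to c. *)
have [||nu1 H1 int1] := @exp_product_tilts _ _ _ _ P (grid m n) hs w
  (boundary_rate a b c) (tiltr hs a a' (boundary_rate a b c)) 1 th ler01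
  (grid_uniq _ _) uhs hsS mw _ _ H.
- move=> v vhs; rewrite /tiltr vhs /boundary_rate -mem_hs ?hsS// vhs/= /th.
  by ring.
- by move=> v; rewrite inE /tiltr => /negbTE->.
rewrite mul1r in H1; set k1 := (\prod_(i <- hs) _)%R in H1.
have k1E : k1 = ((a%:num / (c%:num - b%:num)) ^+ m)%R.
  rewrite /k1 (eq_big_seq (fun=> a%:num / (c%:num - b%:num)))%R; last first.
    by move=> v vhs; rewrite /tiltr vhs /boundary_rate -mem_hs ?hsS// vhs.
  by rewrite big_const_seq count_predT size_map size_iota iter_mulr_1.
have k10 : (0 <= k1)%R by rewrite k1E exprn_ge0// divr_ge0// ltW.
have H1' : exp_product nu1 (grid m n) w (boundary_rate a' b c) k1.
  apply: eq_exp_product H1 => // v vg.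
  by rewrite /tiltr mem_hs// /boundary_rate; case: eqP.
have a'bc : (a'%:num + b%:num = c%:num)%R by rewrite /= subrK.
have [X [mX XE HX]] := burke mw a'bc k10 H1'.
(* The right side keeps its rate b under [nu1], and b - th = c - a. *)
have [||nu2 H2 int2] := @exp_product_tilts _ _ _ _ nu1 (grid m n) vs X
  (boundary_rate a' b c) (tiltr vs b b' (boundary_rate a' b c)) k1 th k10
  (grid_uniq _ _) uvs vsS mX _ _ HX.
- move=> v vvs; rewrite /tiltr vvs /boundary_rate -(mem_vs v) ?vsS// vvs/= /th.
  move/mapP: vvs => [i _ ->]/=; ring.
- by move=> v; rewrite inE /tiltr => /negbTE->.
set k2 := (\prod_(i <- vs) _)%R in H2.
have k2E : k2 = ((b%:num / (c%:num - a%:num)) ^+ n)%R.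
  rewrite /k2 (eq_big_seq (fun=> b%:num / (c%:num - a%:num)))%R; last first.
    move=> v vvs; rewrite /tiltr vvs /boundary_rate -(mem_vs v) ?vsS// vvs.
    by move/mapP: vvs => [i _ ->].
  by rewrite big_const_seq count_predT size_map size_iota iter_mulr_1.
rewrite -k1E -k2E.
have <- : nu2 setT = (k1 * k2)%:E.
  have := H2 (fun=> setT) (fun=> measurableT).
  rewrite big1 ?mule1; last by move=> i _; exact: probability_setT.
  by move=> <-; congr (nu2 _); apply/seteqP; split.
have mL i j : measurable_fun setT (fun t => lpp (w ^~ t) i j).
  exact: measurable_lpp.
have mLexp : measurable_fun setT (fun t => expR (th * (lpp (w ^~ t) m n - lpp (w ^~ t) m 0)))%R.
  apply: measurableT_comp => //; apply: measurable_funM => //.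
  exact: measurable_funB.
have <- : \int[nu2]_t (cst 1 t) = nu2 setT by rewrite integral_cst// mul1e.
rewrite int2//= [RHS](eq_integral (fun t =>
    (expR (th * (lpp (w ^~ t) m n - lpp (w ^~ t) m 0)))%:E)); last first.
  move=> t _; rewrite mul1e; congr (expR (_ * _))%:E.
  have telescope j : (j <= n)%N -> (\sum_(p <- [seq (0%N, i.+1) | i <- iota 0 j]) X p t =
      lpp (w ^~ t) m j - lpp (w ^~ t) m 0)%R.
    elim: j => [|j IH] jn; first by rewrite big_nil subrr.
    rewrite -addn1 iotaD map_cat big_cat/= big_seq1 IH ?(ltnW jn)// addn1 add0n.
    by rewrite XE//; ring.
  exact: telescope.
rewrite int1//; last exact/measurable_EFinP.
  apply: eq_integral => t _.
  by rewrite (@sum_row0_lpp _ (w ^~ t))// -EFinM -expRD -mulrDr subrK.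
Qed.
End mgf_identity.

Section rescaled_weights.
Local Open Scope ereal_scope.
Context d (T : measurableType d) (R : realType) (P : probability T R).
Variables (z : R) (w : nat * nat -> {RV P >-> R}).
Hypothesis z01 : (0 < z < 1)%R.
Hypothesis wz : increment_stationary_weights z w.

(** Rescaling produces every pair of axis rates on the given probability space,
    so that passage times for different rates can be compared pointwise.
    Absolute values make the weights nonnegative everywhere, and not only
    almost surely. *)
Definition rescaled_weights (a b : R) (v : nat * nat) (t : T) : R :=
  if v == (0, 0)%N then 0%R
  else if v.2 == 0%N then (z / a * `|w v t|)%R
  else if v.1 == 0%N then ((1 - z) / b * `|w v t|)%R
  else `|w v t|%R.

Lemma measurable_rescaled_weights a b v :
  measurable_fun setT (rescaled_weights a b v).
Proof.
have mw : measurable_fun setT (fun t => `|w v t|)%R.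
  by apply: measurableT_comp => //; exact: normr_measurable.
rewrite /rescaled_weights; case: (v == (0, 0)%N); first exact: measurable_cst.
case: (v.2 == 0%N); first exact: measurable_funM.
by case: (v.1 == 0%N) => //; exact: measurable_funM.
Qed.

Lemma rescaled_weights_exp_product (a b : {posnum R}) (m n : nat) :
  exp_product P (grid m n) (rescaled_weights a%:num b%:num)
    (boundary_rate a b (PosNum (@ltr01 R))) 1.
Proof.
move=> B mB; have [wind w00 w1 wz1 wz2] := wz.
have [z0 z1] := andP z01.
have z'0 : (0 < 1 - z)%R by rewrite subr_gt0.
pose r := boundary_rate (PosNum z0) (PosNum z'0) (PosNum (@ltr01 R)).
pose r' := boundary_rate a b (PosNum (@ltr01 R)).
pose B' v : set R := [set y | B v ((r v)%:num / (r' v)%:num * `|y|)%R].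
have mB' v : measurable (B' v).
  apply: measurable_fun_set => //.
  by apply: measurable_funM => //; exact: normr_measurable.
have wB v t : v \in grid m n ->
    B v (rescaled_weights a%:num b%:num v t) = B' v (w v t).
  rewrite mem_grid => /andP[/negbTE v0 _].
  rewrite /rescaled_weights /B' v0 /r /r' /boundary_rate/=.
  case: eqP => // _; case: eqP => // _.
  by rewrite divr1 mul1r.
rewrite mul1e (_ : [set _ | _] = \bigcap_(v in [set` grid m n]) (w v @^-1` B' v)); last first.
  by apply/seteqP; split=> t /= Ht v vg; have := Ht v vg; rewrite wB.
apply: (etrans (wind (grid m n) B' (grid_uniq m n) mB')); apply: eq_big_seq => v vg.
transitivity (exp_law (r v) (B' v)); last exact: exp_law_scale.
move: vg; rewrite mem_grid => /andP[v0 _].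
move: (B' v) (mB' v) => D mD {mB' wB}.
rewrite /r /boundary_rate; case: v v0 => i j v0 /=.
have [j0|j0] := eqVneq j 0%N.
  move: v0; rewrite j0 => v0; apply: wz1 => //.
  by rewrite lt0n; apply: contra v0 => /eqP->.
have [i0|i0] := eqVneq i 0%N; last by apply: w1; rewrite ?lt0n.
by rewrite i0; apply: wz2; rewrite ?lt0n.
Qed.

Lemma rescaled_lpp_mgf (a b : R) (m n : nat) : (0 < a < 1)%R -> (0 < b < 1)%R ->
  \int[P]_t (expR ((a + b - 1) * lpp (rescaled_weights a b ^~ t) m n))%:E =
  ((a / (1 - b)) ^+ m * (b / (1 - a)) ^+ n)%:E.
Proof.
move=> /andP[a0 a1] /andP[b0 b1].
apply: (@lpp_mgf _ T R P m n _ (PosNum a0) (PosNum b0) (PosNum (@ltr01 R))) => //.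
- exact: measurable_rescaled_weights.
- exact: (@rescaled_weights_exp_product (PosNum a0) (PosNum b0)).
Qed.

End rescaled_weights.

(** * Tail probabilities in terms of exponential moments *)

Section tail_probability.
Context d (T : measurableType d) (R : realType) (P : probability T R).
Variables (z : R) (w : nat * nat -> {RV P >-> R}) (m n : nat).
Hypothesis z01 : 0 < z < 1.
Hypothesis wz : increment_stationary_weights z w.

(** The exponential moment of order a + b - 1 of the passage time with axis
    rates a and b. *)
Definition boundary_mgf (a b : R) : R := (a / (1 - b)) ^+ m * (b / (1 - a)) ^+ n.

Let lppab a b t := lpp (rescaled_weights z w a b ^~ t) m n.
Let hor t := lpp (zero_vertical (fun v => `|w v t|)) m n.
Let ver t := lpp (zero_horizontal (fun v => `|w v t|)) m n.
Let w00 t : w (0, 0)%N t = 0. Proof. by have [] := wz. Qed.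

Let z0 : 0 < z. Proof. by case/andP: z01. Qed.
Let z'0 : 0 < 1 - z. Proof. by rewrite subr_gt0; case/andP: z01. Qed.

Let rescaled_ge0 a b v t : 0 < a -> 0 < b -> 0 <= rescaled_weights z w a b v t.
Proof.
move=> a0 b0; rewrite /rescaled_weights; case: ifP => // _.
case: ifP => _; first by rewrite mulr_ge0// divr_ge0// ltW.
by case: ifP => // _; rewrite mulr_ge0// divr_ge0// ltW.
Qed.

(** Erasing the vertical axis removes the dependence on its rate: one variable
    [hor] lies below the passage times for all vertical rates, and likewise
    [ver] for all horizontal ones. *)
Let hor_le b t : 0 < b -> hor t <= lppab z b t.
Proof.
move=> b0; apply: le_lpp => -[i j]; rewrite /zero_vertical/=.
case: eqP => [_|/eqP i0]; first exact: rescaled_ge0.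
rewrite /rescaled_weights xpair_eqE (negbTE i0)/= (divff (lt0r_neq0 z0)) mul1r.
by case: ifP.
Qed.

Let ver_le a t : 0 < a -> ver t <= lppab a (1 - z) t.
Proof.
move=> a0; apply: le_lpp => -[i j]; rewrite /zero_horizontal/=.
case: eqP => [_|/eqP j0]; first exact: rescaled_ge0.
rewrite /rescaled_weights xpair_eqE (negbTE j0) andbF/= (divff (lt0r_neq0 z'0)) mul1r.
by case: ifP.
Qed.

Let lppab_le a b t : 0 < a -> 0 < b -> lppab z b t <= Num.max (hor t) (lppab a b t).
Proof.
move=> a0 b0; apply: le_trans (lpp_le_max_zero _ _ _) _.
  by rewrite /rescaled_weights eqxx.
rewrite ge_max !le_max; apply/andP; split; apply/orP; [left|right].
  apply: le_lpp => -[i j]; rewrite /zero_vertical/=.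
  case: eqP => // /eqP i0; rewrite /rescaled_weights xpair_eqE (negbTE i0)/=.
  by rewrite (divff (lt0r_neq0 z0)) mul1r; case: ifP.
apply: le_lpp => -[i j]; rewrite /zero_horizontal/=.
case: eqP => [_|/eqP j0]; first exact: rescaled_ge0.
by rewrite /rescaled_weights xpair_eqE (negbTE j0) andbF.
Qed.

Let Ghat_le t : Ghat w m n t <= Num.max (hor t) (ver t).
Proof.
rewrite /Ghat last_passageE; apply: (@le_trans _ _ (lpp (fun v => `|w v t|) m n)).
  by apply: le_lpp => v; exact: ler_norm.
by apply: lpp_le_max_zero; rewrite w00 normr0.
Qed.

Let mabs v : measurable_fun setT (fun t => `|w v t|).
Proof. by apply: measurableT_comp => //; exact: normr_measurable. Qed.

Let mhor : measurable_fun setT hor.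
Proof.
apply: (@measurable_lpp _ _ _ (fun v t => zero_vertical (fun v => `|w v t|) v)).
by move=> v; rewrite /zero_vertical; case: (v.1 == 0%N).
Qed.

Let mver : measurable_fun setT ver.
Proof.
apply: (@measurable_lpp _ _ _ (fun v t => zero_horizontal (fun v => `|w v t|) v)).
by move=> v; rewrite /zero_horizontal; case: (v.2 == 0%N).
Qed.

Let mlppab a b : measurable_fun setT (lppab a b).
Proof. by apply: measurable_lpp => v; exact: measurable_rescaled_weights. Qed.

Let mGhat : measurable_fun setT (Ghat w m n).
Proof.
rewrite (_ : Ghat w m n = fun t => lpp (fun v => w v t) m n); last first.
  by apply/funext => t; rewrite /Ghat last_passageE.
by apply: (@measurable_lpp _ _ _ (fun v t => w v t)).
Qed.

Let mge (f : T -> R) x : measurable_fun setT f -> measurable [set t | x <= f t].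
Proof.
move=> mf; rewrite (_ : [set t | _] = f @^-1` `[x, +oo[).
  by rewrite -[X in measurable X]setTI; exact: mf.
by apply/seteqP; split=> t /=; rewrite in_itv/= andbT.
Qed.

Let mgf a b : 0 < a < 1 -> 0 < b < 1 ->
  (\int[P]_t (expR ((a + b - 1) * lppab a b t))%:E = (boundary_mgf a b)%:E)%E.
Proof. exact: rescaled_lpp_mgf. Qed.

Let markov_exp (f g : T -> R) l x : measurable_fun setT f ->
    measurable_fun setT g -> 0 <= l -> (forall t, f t <= g t) ->
  (P [set t | (x <= f t)%R] <=
   (expR (- l * x))%:E * \int[P]_t (expR (l * g t)%R)%:E)%E.
Proof.
move=> mf mg l0 fg.
have me : measurable_fun setT (fun t => (expR (l * g t))%:E).
  apply/measurable_EFinP; apply: measurableT_comp => //.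
  exact: measurable_funM.
rewrite -(ge0_integralZl_EFin _ measurableT) ?expR_ge0//.
rewrite -[X in P X]setIT -(integral_indic _ measurableT); last exact: mge.
apply: ge0_le_integral => //.
- by apply/measurable_EFinP; apply: measurable_indic; exact: mge.
- exact: measurable_funeM.
move=> t _; rewrite -EFinM -expRD lee_fin indicE.
have [/set_mem/= xf|_] := boolP (_ \in _); last exact: expR_ge0.
rewrite -[leLHS]expR0 ler_expR mulNr addrC subr_ge0 ler_wpM2l//.
exact: le_trans xf (fg t).
Qed.

(** The union bound over the axis along which the path leaves, and Markov's
    inequality with an arbitrary rate on the axis that was erased. *)
Lemma Ghat_tail_le (a b x : R) : z < a < 1 -> 1 - z < b < 1 ->
  (P [set t | (x <= Ghat w m n t)%R] <=
   (expR (- (z + b - 1) * x) * boundary_mgf z b +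
    expR (- (a - z) * x) * boundary_mgf a (1 - z))%:E)%E.
Proof.
move=> /andP[za a1] /andP[zb b1].
have a0 : 0 < a by exact: lt_trans za.
have b0 : 0 < b by exact: lt_trans zb.
apply: (@le_trans _ _ (P ([set t | (x <= hor t)%R] `|` [set t | (x <= ver t)%R]))).
  apply: le_measure; rewrite ?inE//; first exact: mge.
    by apply: measurableU; exact: mge.
  by move=> t /= xG; have := le_trans xG (Ghat_le t); rewrite le_max => /orP.
apply: le_trans (measureU2 _ _ _) _; [exact: mge|exact: mge|].
rewrite EFinD; apply: leeD.
  rewrite EFinM -mgf//; last by rewrite b0.
  by apply: markov_exp => //; [lra|move=> t; exact: hor_le].
rewrite EFinM -mgf//; last 2 first.
- by rewrite a0.
- by rewrite z'0/=; lra.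
rewrite (_ : a + (1 - z) - 1 = a - z); last by ring.
by apply: markov_exp => //; [lra|move=> t; exact: ver_le].
Qed.

Let weights_ge0 : {ae P, forall t, forall v, 0 <= w v t}.
Proof.
have neg0 (r : {posnum R}) : exp_law r [set x | x < 0] = 0%E.
  rewrite exp_law_density; last by rewrite -set_itvNyo.
  by apply: integral0_eq => x x0; rewrite lt0_exponential_pdf.
have N0 v : P.-negligible [set t | w v t < 0].
  exists [set t | w v t < 0]; split => //.
    rewrite -[X in measurable X]setTI.
    have := @measurable_funPT _ _ _ _ (w v).
    by move=> /(_ measurableT [set x | x < 0]); apply; rewrite -set_itvNyo.
  have mlt : measurable [set x : R | x < 0] by rewrite -set_itvNyo.
  have [_ _ w1 wz1 wz2] := wz.
  case: v => -[|i] [|j].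
  - rewrite (_ : [set t | _] = set0) ?measure0//.
    by apply/seteqP; split => t //=; rewrite w00 ltxx.
  - exact: etrans (wz2 j.+1 isT _ mlt) (neg0 (PosNum z'0)).
  - exact: etrans (wz1 i.+1 isT _ mlt) (neg0 (PosNum z0)).
  - exact: etrans (w1 i.+1 j.+1 isT isT _ mlt) (neg0 (PosNum ltr01)).
apply: (@negligibleS _ _ _ _ (\bigcup_k
  if unpickle k is Some v then [set t | w v t < 0] else set0)); last first.
  by apply: negligible_bigcup => k; case: unpickle => // ; exact: negligible_set0.
move=> t /= /existsNP[v /negP]; rewrite -ltNge => wv0.
by exists (pickle v) => //=; rewrite pickleK.
Qed.

(** The passage time dominates [hor] wherever the weights are nonnegative,
    which is almost everywhere. *)
Let hor_tail x : (P [set t | (x <= hor t)%R] <= P [set t | (x <= Ghat w m n t)%R])%E.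
Proof.
have [N [mN N0 hN]] := weights_ge0.
rewrite -[leRHS](measureU0 _ mN N0)//; last exact: mge.
apply: le_measure; rewrite ?inE//; first exact: mge.
  by apply: measurableU => //; exact: mge.
move=> t /= xH; have [Nt|Nt] := pselect (N t); [by right|left].
apply: le_trans xH _; rewrite /Ghat last_passageE; apply: le_lpp => v.
have wt0 u : 0 <= w u t.
  by apply: contrapT => wu; apply: Nt; apply: hN => wt; exact: wu (wt u).
by rewrite /zero_vertical; case: ifP => // _; rewrite ger0_norm.
Qed.

(** The exponential moment of the passage time L with axis rates z and b is
    split over five events. Either L <= [hor], and [hor] is below x, between x
    and x', or above x': in the extreme cases exp ((z + b - 1) L) is compared
    with the exponential of smaller order z + b0 - 1, respectively of larger
    order z + b2 - 1, and the middle case contributes the probability in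
    question. Or L is attained along the vertical axis, hence does not see the
    horizontal rate and is at most the passage time with axis rates a and b;
    here the levels below and above y are distinguished. *)
Lemma Ghat_tail_ge (a b b0 b2 x x' y : R) : z < a < 1 ->
    1 - z < b0 -> b0 < b -> b < b2 -> b2 < 1 ->
  boundary_mgf z b <= expR ((b - b0) * x) * boundary_mgf z b0 +
    expR ((z + b - 1) * x') * fine (P [set t | (x <= Ghat w m n t)%R]) +
    expR (- (b2 - b) * x') * boundary_mgf z b2 +
    expR ((z + b - 1) * y) + expR (- (a - z) * y) * boundary_mgf a b.
Proof.
move=> /andP[za a1] zb0 b0b bb2 b21.
have a0 : 0 < a by exact: lt_trans za.
have b00 : 0 < b0 by exact: lt_trans zb0.
have b_0 : 0 < b by exact: lt_trans b0b.
have b20 : 0 < b2 by exact: lt_trans bb2.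
have [b_1 b01] : b < 1 /\ b0 < 1 by split; lra.
pose e (l : R) (g : T -> R) (t : T) : R := expR (l * g t).
have me l g : measurable_fun setT g -> measurable_fun setT (fun t => (e l g t)%:E).
  move=> mg; apply/measurable_EFinP; apply: measurableT_comp => //.
  exact: measurable_funM.
have pointwise t : e (z + b - 1) (lppab z b) t <=
    expR ((b - b0) * x) * e (z + b0 - 1) (lppab z b0) t +
    expR ((z + b - 1) * x') * \1_[set t | x <= hor t] t +
    expR (- (b2 - b) * x') * e (z + b2 - 1) (lppab z b2) t +
    expR ((z + b - 1) * y) + expR (- (a - z) * y) * e (a + b - 1) (lppab a b) t.
  have E0 (u : R) : 0 <= expR u by exact: expR_ge0.
  have E1 : 0 <= expR ((b - b0) * x) * e (z + b0 - 1) (lppab z b0) t by exact: mulr_ge0 (E0 _) (E0 _).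
  have E2 : 0 <= expR ((z + b - 1) * x') * \1_[set t | x <= hor t] t :> R by rewrite mulr_ge0.
  have E3 : 0 <= expR (- (b2 - b) * x') * e (z + b2 - 1) (lppab z b2) t by exact: mulr_ge0 (E0 _) (E0 _).
  have E4 : 0 <= expR ((z + b - 1) * y) by [].
  have E5 : 0 <= expR (- (a - z) * y) * e (a + b - 1) (lppab a b) t by exact: mulr_ge0 (E0 _) (E0 _).
  have := lppab_le t a0 b_0; rewrite le_max => /orP[Gh|Gab].
    rewrite -[leRHS]addrA ler_wpDr ?(addr_ge0 E4 E5)//.
    rewrite -[leLHS]/(expR ((z + b - 1) * lppab z b t)).
    have h0 := hor_le t b00; have h2 := hor_le t b20.
    have [xH|Hx] := leP x (hor t); last first.
      suff : expR ((z + b - 1) * lppab z b t) <=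
          expR ((b - b0) * x) * e (z + b0 - 1) (lppab z b0) t by lra.
      by rewrite /e -expRD ler_expR; nra.
    have [Hx'|x'H] := leP (hor t) x'.
      suff : expR ((z + b - 1) * lppab z b t) <=
          expR ((z + b - 1) * x') * \1_[set t | x <= hor t] t by lra.
      by rewrite indicE mem_set// mulr1 ler_expR; nra.
    suff : expR ((z + b - 1) * lppab z b t) <=
        expR (- (b2 - b) * x') * e (z + b2 - 1) (lppab z b2) t by lra.
    by rewrite /e -expRD ler_expR; nra.
  have [Vy|yV] := leP (lppab a b t) y.
    rewrite (ler_wpDr E5)// ler_wpDl ?(addr_ge0 (addr_ge0 E1 E2) E3)//.
    by rewrite ler_expR; nra.
  rewrite ler_wpDl ?(addr_ge0 (addr_ge0 (addr_ge0 E1 E2) E3) E4)//.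
  by rewrite /e -expRD ler_expR; nra.
have mH : measurable [set t | x <= hor t] by exact: mge.
have intD (f g : T -> R) : measurable_fun setT f -> measurable_fun setT g ->
    (forall t, 0 <= f t) -> (forall t, 0 <= g t) ->
    (\int[P]_t (f t + g t)%:E = \int[P]_t (f t)%:E + \int[P]_t (g t)%:E)%E.
  move=> mf mg f0 g0; rewrite -ge0_integralD//.
  - by move=> t _; rewrite lee_fin.
  - exact/measurable_EFinP.
  - by move=> t _; rewrite lee_fin.
  - exact/measurable_EFinP.
have intZ (k : R) (f : T -> R) : measurable_fun setT f -> 0 <= k ->
    (forall t, 0 <= f t) ->
    (\int[P]_t (k * f t)%:E = k%:E * \int[P]_t (f t)%:E)%E.
  move=> mf k_ge0 f0; rewrite -(ge0_integralZl_EFin _ measurableT)//.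
  - by move=> t _; rewrite lee_fin.
  - exact/measurable_EFinP.
have mI : measurable_fun setT (\1_[set t | x <= hor t] : T -> R).
  exact: measurable_indic.
have me' l g : measurable_fun setT g -> measurable_fun setT (e l g).
  by move=> mg; apply/measurable_EFinP; exact: me.
have e0 l g t : 0 <= e l g t by exact: expR_ge0.
have intE a' b' : 0 < a' < 1 -> 0 < b' < 1 ->
    (\int[P]_t (e (a' + b' - 1) (lppab a' b') t)%:E = (boundary_mgf a' b')%:E)%E.
  by move=> ? ?; rewrite -mgf.
have pE : (P [set t | (x <= Ghat w m n t)%R] =
    (fine (P [set t | x <= Ghat w m n t]))%:E)%E.
  by rewrite fineK// fin_num_measure//; exact: mge.
have fI : (\int[P]_t (\1_[set t | (x <= hor t)%R] t)%:E <=
    (fine (P [set t | (x <= Ghat w m n t)%R]))%:E)%E.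
  by rewrite -pE integral_indic// setIT; exact: hor_tail.
have E0 (u : R) : 0 <= expR u by exact: expR_ge0.
have mZ (k : R) (f : T -> R) : measurable_fun setT f -> measurable_fun setT (fun t => k * f t).
  by move=> mf; exact: measurable_funM.
have Z0 (k : R) (f : T -> R) : 0 <= k -> (forall t, 0 <= f t) -> forall t, 0 <= k * f t.
  by move=> k_ge0 f0 t; exact: mulr_ge0.
rewrite -lee_fin -intE ?z01 ?b_0//.
have m1 := mZ (expR ((b - b0) * x)) _ (me' (z + b0 - 1) _ (mlppab z b0)).
have m2 := mZ (expR ((z + b - 1) * x')) _ mI.
have m3 := mZ (expR (- (b2 - b) * x')) _ (me' (z + b2 - 1) _ (mlppab z b2)).
have m4 := @measurable_cst _ _ T R setT (expR ((z + b - 1) * y)).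
have m5 := mZ (expR (- (a - z) * y)) _ (me' (a + b - 1) _ (mlppab a b)).
have p1 := Z0 (expR ((b - b0) * x)) _ (E0 _) (e0 (z + b0 - 1) (lppab z b0)).
have p2 := Z0 (expR ((z + b - 1) * x')) (\1_[set t | x <= hor t]) (E0 _) (fun=> ler0n _ _).
have p3 := Z0 (expR (- (b2 - b) * x')) _ (E0 _) (e0 (z + b2 - 1) (lppab z b2)).
have p5 := Z0 (expR (- (a - z) * y)) _ (E0 _) (e0 (a + b - 1) (lppab a b)).
have m12 := measurable_funD m1 m2.
have m123 := measurable_funD m12 m3.
have m1234 := measurable_funD m123 m4.
have p12 t := addr_ge0 (p1 t) (p2 t).
have p123 t := addr_ge0 (p12 t) (p3 t).
have p1234 t := addr_ge0 (p123 t) (E0 ((z + b - 1) * y)).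
have mF := measurable_funD m1234 m5.
have pF t := addr_ge0 (p1234 t) (p5 t).
have s4 := intD _ _ m1234 m5 p1234 p5.
have s3 := intD _ _ m123 m4 p123 (fun=> E0 _).
have s2 := intD _ _ m12 m3 p12 p3.
have s1 := intD _ _ m1 m2 p1 p2.
have EF := etrans s4 (congr2 adde (etrans s3 (congr2 adde (etrans s2
  (congr2 adde s1 erefl)) erefl)) erefl).
have LF : (\int[P]_t (e (z + b - 1) (lppab z b) t)%:E <= \int[P]_t
    (((fun t => expR ((b - b0) * x) * e (z + b0 - 1) (lppab z b0) t) \+
      (fun t => expR ((z + b - 1) * x') * \1_[set t | x <= hor t] t) \+
      (fun t => expR (- (b2 - b) * x') * e (z + b2 - 1) (lppab z b2) t) \+
      cst (expR ((z + b - 1) * y)) \+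
      (fun t => expR (- (a - z) * y) * e (a + b - 1) (lppab a b) t)) t)%R%:E)%E.
  apply: ge0_le_integral.
  - exact: measurableT.
  - by move=> t _; rewrite lee_fin; exact: e0.
  - by apply: me; exact: mlppab.
  - exact/measurable_EFinP.
  - by move=> t _; rewrite lee_fin; exact: pointwise.
apply: (le_trans LF); rewrite [leLHS]EF !EFinD.
apply: leeD.
  apply: leeD.
    apply: leeD.
      apply: leeD.
        rewrite intZ//; last by apply: me'; exact: mlppab.
        by rewrite intE ?z01 ?b00 ?b01// EFinM.
      rewrite intZ// EFinM; apply: lee_wpmul2l; last exact: fI.
      by rewrite lee_fin.
    rewrite intZ//; last by apply: me'; exact: mlppab.
    by rewrite intE ?z01 ?b20 ?b21// EFinM.
  rewrite -[leLHS]/(\int[P]_t cst (expR ((z + b - 1) * y))%:E t)%E.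
  rewrite integral_cst//; have := probability_setT P; rewrite /= => ->.
  by rewrite mule1.
rewrite intZ//; last by apply: me'; exact: mlppab.
by rewrite intE ?a0 ?a1 ?b_0 ?b_1// EFinM.
Qed.

End tail_probability.

(** * The rate function near its cubic critical point *)

Section rate_function.
Context {R : realType}.
Implicit Types c t u v h : R.

(** At t = c the first derivative is 1 and the second one vanishes, so the
    linear term dominates and the correction to it is cubic. *)
Definition entropy c t : R := c ^+ 2 * ln t - (1 - c) ^+ 2 * ln (1 - t).

Lemma is_derive_entropy c t : 0 < t < 1 ->
  is_derive t 1 (entropy c) (c ^+ 2 / t + (1 - c) ^+ 2 / (1 - t)).
Proof.
move=> /andP[t0 t1].
have t'0 : 0 < 1 - t by rewrite subr_gt0.
have d1 := is_derive1_ln t0.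
have d2 : is_derive t 1 (fun x => 1 - x : R) (-1).
  have H := is_deriveB (is_derive_cst (1 : R) t 1) (is_derive_id t (1 : R)).
  by apply: (is_derive_eq H); rewrite sub0r.
have d3 := @is_derive1_comp _ (@ln R) (fun x => 1 - x) t _ _ (is_derive1_ln t'0) d2.
have dZ1 := is_deriveZ (c ^+ 2) d1.
have dZ2 := is_deriveZ ((1 - c) ^+ 2) d3.
have := is_deriveB dZ1 dZ2.
move=> H; apply: (is_derive_eq H).
by rewrite /GRing.scale/=; ring.
Qed.

Lemma MVT_derivable (f df : R -> R) (a b : R) : a < b ->
    (forall t, a <= t <= b -> is_derive t 1 f (df t)) ->
  exists2 x, a < x < b & f b - f a = df x * (b - a).
Proof.
move=> ab H.
have dH t : t \in `]a, b[ -> is_derive t 1 f (df t).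
  by rewrite in_itv/= => /andP[/ltW ? /ltW ?]; apply: H; apply/andP.
have cH : {within `[a, b], continuous f}.
  by apply: derivable_within_continuous => t; rewrite in_itv/= => /H [].
have [x xab E] := MVT ab dH cH.
by exists x => //; move: xab; rewrite in_itv.
Qed.

(** With c = zeta, sg = sigma and prefactor c (1 - c) sg^3 = gamma, this is the
    nonlinear part of the logarithm of [boundary_mgf], in the scale where it is
    close to u^3 / 3. *)
Definition rate c sg u : R :=
  c * (1 - c) * sg ^+ 3 * (entropy c (c + u / sg) - entropy c c - u / sg).

(** The derivative of [rate], written so that its double zero is visible. *)
Definition slope c sg u : R :=
  u ^+ 2 * (c * (1 - c)) / ((c + u / sg) * (1 - c - u / sg)).

Lemma rate0 c sg : rate c sg 0 = 0.
Proof. by rewrite /rate mul0r addr0 !subrr mulr0. Qed.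

Let slopeE c h : 0 < c + h < 1 ->
  c ^+ 2 / (c + h) + (1 - c) ^+ 2 / (1 - (c + h)) =
  1 + h ^+ 2 / ((c + h) * (1 - c - h)).
Proof.
move=> /andP[h0 h1]; have h1' : 0 < 1 - (c + h) by rewrite subr_gt0.
have -> : 1 - c - h = 1 - (c + h) by ring.
by field; rewrite !gt_eqF.
Qed.

Lemma is_derive_rate c sg u : 0 < sg -> 0 < c + u / sg < 1 ->
  is_derive u 1 (rate c sg) (slope c sg u).
Proof.
move=> sg0 u01.
have d1 : is_derive u 1 (fun x => c + sg^-1 * x) sg^-1.
  have H := is_deriveD (is_derive_cst c u 1) (is_deriveZ sg^-1 (is_derive_id u (1 : R))).
  by apply: (is_derive_eq H); rewrite add0r /GRing.scale/= mulr1.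
have d2 : is_derive u 1 (fun x => sg^-1 * x) sg^-1.
  have H := is_deriveZ sg^-1 (is_derive_id u (1 : R)).
  by apply: (is_derive_eq H); rewrite /GRing.scale/= mulr1.
have u01' : 0 < c + sg^-1 * u < 1 by rewrite (mulrC sg^-1).
have d3 := @is_derive1_comp _ (entropy c) _ u _ _ (is_derive_entropy c u01') d1.
have := is_deriveZ (c * (1 - c) * sg ^+ 3)
  (is_deriveB (is_deriveB d3 (is_derive_cst (entropy c c) u 1)) d2).
set G := (X in is_derive _ _ X _) => H.
have -> : rate c sg = G.
  apply/funext => x; rewrite /G /rate /GRing.scale/=.
  by rewrite !fctE/= (mulrC sg^-1).
apply: (is_derive_eq H); rewrite subr0 /GRing.scale/= (mulrC sg^-1 u).
rewrite slopeE// /slope.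
case/andP: u01 => t0 t1; have t1' : 0 < 1 - c - u / sg by lra.
set A := c + u / sg in t0 *; set B := 1 - c - u / sg in t1' *.
by field; rewrite !gt_eqF.
Qed.

Lemma rate_MVT c sg u v : 0 < sg -> u < v -> 0 < c + u / sg -> c + v / sg < 1 ->
  exists2 x, u < x < v & rate c sg v - rate c sg u = slope c sg x * (v - u).
Proof.
move=> sg0 uv u0 v1; apply: (@MVT_derivable (rate c sg) (slope c sg) u v uv).
move=> t /andP[ut tv]; apply: is_derive_rate => //; apply/andP; split.
  by apply: (lt_le_trans u0); rewrite lerD2l ler_pM2r ?invr_gt0.
by apply: (le_lt_trans _ v1); rewrite lerD2l ler_pM2r ?invr_gt0.
Qed.

Section estimates.
Variables (e c sg : R).
Hypotheses (e0 : 0 < e) (ec : e <= c) (ce : c <= 1 - e) (sg0 : 0 < sg).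

Let k := c * (1 - c).
Let ke : e / 2 <= k.
Proof.
move: (e0) (ec) (ce) => e_0 e_c c_e.
have h1 : 0 <= (c - e) * (1 - e - c) by rewrite mulr_ge0//; lra.
have h2 : 0 <= e * (1 / 2 - e) by rewrite mulr_ge0//; lra.
by rewrite /k; lra.
Qed.

Let small u : `|u| <= e / 100 * sg -> `|u / sg| <= e / 100.
Proof.
by move=> u_le; rewrite normrM normfV (gtr0_norm sg0) ler_pdivrMr. Qed.

Let den_near h : `|h| <= e / 100 -> `|(c + h) * (1 - c - h) - k| <= 101 / 100 * `|h|.
Proof.
move: (e0) (ec) (ce) (sg0) => e_0 e_c c_e s_0.
move=> h_le; rewrite (_ : _ - k = h * (1 - 2 * c - h)); last by rewrite /k; ring.
rewrite normrM mulrC ler_wpM2r// ler_norml.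
by move: h_le; rewrite ler_norml => /andP[? ?]; apply/andP; split; nra.
Qed.

Let den_ge h : `|h| <= e / 100 -> 12 / 25 * e <= (c + h) * (1 - c - h).
Proof.
move: (e0) (ec) (ce) (sg0) => e_0 e_c c_e s_0.
move=> h_le; have := den_near h_le.
by have := ke; rewrite ler_norml => ? /andP[? ?]; lra.
Qed.

Lemma in_range u : `|u| <= e / 100 * sg -> 0 < c + u / sg < 1.
Proof.
move: (e0) (ec) (ce) (sg0) => e_0 e_c c_e s_0.
by move=> /small; rewrite ler_norml => /andP[? ?]; apply/andP; split; lra.
Qed.

(** The factor of u^2 is c (1 - c) / ((c + h) (1 - c - h)) with h = u / sg. The
    numerator is at least e / 2, and the two products differ by little more
    than h. *)
Lemma slope_near_square u : `|u| <= e / 100 * sg ->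
  `|slope c sg u - u ^+ 2| <= 5 / e * (`|u| ^+ 3 / sg).
Proof.
move: (e0) (ec) (ce) (sg0) => e_0 e_c c_e s_0.
move=> u_le; have h_le := small u_le.
have D0 := den_ge h_le; have Dn := den_near h_le; rewrite /slope -/k.
set D := (c + u / sg) * (1 - c - u / sg) in D0 Dn *.
have D_gt0 : 0 < D by lra.
have -> : u ^+ 2 * k / D - u ^+ 2 = u ^+ 2 * ((k - D) / D).
  by field; rewrite gt_eqF.
rewrite normrM normrX !exprS expr0 mulr1.
have -> : 5 / e * (`|u| * (`|u| * `|u|) / sg) = `|u| * `|u| * (5 / e * (`|u| / sg)).
  by ring.
rewrite ler_wpM2l ?mulr_ge0// normrM normfV (gtr0_norm D_gt0) ler_pdivrMr//.
rewrite distrC (le_trans Dn)// normrM normfV (gtr0_norm sg0).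
set h := `|u| / sg; have h0 : 0 <= h by rewrite divr_ge0// ltW.
have -> : 5 / e * h * D = h * (5 / e * D) by ring.
rewrite mulrC ler_wpM2l//.
apply: (@le_trans _ _ (5 / e * (12 / 25 * e))); last by rewrite ler_wpM2l ?divr_ge0// ltW.
have -> : 5 / e * (12 / 25 * e) = 12 / 5 by field; rewrite gt_eqF.
by lra.
Qed.

(** The difference vanishes at 0, and its derivative is bounded by
    [slope_near_square] between 0 and u. *)
Lemma rate_near_cube u : `|u| <= e / 100 * sg ->
  `|rate c sg u - u ^+ 3 / 3| <= 5 / e * (u ^+ 4 / sg).
Proof.
move: (e0) (ec) (ce) (sg0) => e_0 e_c c_e s_0.
move=> u_le.
pose phi := fun x : R => rate c sg x - x ^+ 3 / 3.
have dphi (x : R) : `|x| <= e / 100 * sg -> is_derive x 1 phi (slope c sg x - x ^+ 2).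
  move=> x_le; have d1 := is_derive_rate sg0 (in_range x_le).
  have d2 := is_deriveZ (3^-1 : R) (is_deriveX 3 (is_derive_id x (1 : R))).
  have := is_deriveB d1 d2; set G := (X in is_derive _ _ X _) => H.
  have -> : phi = G.
    apply/funext => y; rewrite /G /phi /GRing.scale/= !fctE/=.
    by rewrite mulrC.
  apply: (is_derive_eq H); rewrite /GRing.scale/=; congr (_ - _).
  by rewrite /GRing.scale/= mulr1 mulr_natl; field.
have phi0 : phi 0 = 0 by rewrite /phi rate0 expr0n/= mul0r subr0.
have step x : `|x| <= `|u| -> `|slope c sg x - x ^+ 2| <= 5 / e * (`|u| ^+ 3 / sg).
  move=> xu; apply: le_trans (slope_near_square (le_trans xu u_le)) _.
  rewrite ler_wpM2l ?divr_ge0 ?(ltW e0)// ler_wpM2r ?invr_ge0 ?(ltW sg0)//.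
  by apply: lerXn2r; rewrite ?nnegrE.
have fin : `|phi u| <= 5 / e * (`|u| ^+ 3 / sg) * `|u|.
  have [u0|u0|->] := ltgtP u 0; last first.
  - by rewrite phi0 !normr0 mulr0.
  - have dx x : 0 <= x <= u -> is_derive x 1 phi (slope c sg x - x ^+ 2).
      move=> /andP[x1 x2]; apply: dphi; apply: le_trans u_le.
      by rewrite !ger0_norm// ltW.
    have [x /andP[x1 x2] E] := MVT_derivable u0 dx.
    rewrite phi0 !subr0 in E; rewrite E normrM ler_wpM2r//; apply: step.
    by rewrite !gtr0_norm// ltW.
  - have dx x : u <= x <= 0 -> is_derive x 1 phi (slope c sg x - x ^+ 2).
      move=> /andP[x1 x2]; apply: dphi; apply: le_trans u_le.
      by rewrite !ler0_norm// ?lerN2// ltW.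
    have [x /andP[x1 x2] E] := MVT_derivable u0 dx.
    rewrite phi0 !sub0r in E.
    rewrite -normrN E normrM normrN ler_wpM2r//; apply: step.
    by rewrite !ltr0_norm// lerN2 ltW.
have u4 : u ^+ 4 = `|u| ^+ 3 * `|u|.
  by rewrite -exprSr -normrX ger0_norm// (exprM u 2 2) sqr_ge0.
by apply: (le_trans fin); rewrite u4 le_eqVlt; apply/orP; left; apply/eqP; ring.
Qed.

(** On the negative side [slope] grows like the square, up to a factor of 2.
    The factor v - u is extracted exactly: subtracting two approximations from
    [slope_near_square] would say nothing about points at distance 1. *)
Lemma slope_increment u v : 0 <= u -> u < v -> v <= e / 100 * sg ->
  (v - u) * (v + u) / 2 <= slope c sg (- v) - slope c sg (- u) <=
  2 * ((v - u) * (v + u)).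
Proof.
move: (e0) (ec) (ce) (sg0) => e_0 e_c c_e s_0.
move=> u0 uv v_le; have v0 : 0 < v by exact: le_lt_trans uv.
have un : `|- u| <= e / 100 * sg by rewrite normrN ger0_norm//; lra.
have vn : `|- v| <= e / 100 * sg by rewrite normrN gtr0_norm.
have [Du Dv] := (den_near (small un), den_near (small vn)).
have [Hu Hv] := (small un, small vn).
rewrite /slope -/k !mulNr !opprK !sqrrN in Du Dv Hu Hv *.
set p := u / sg in Du Hu *; set q := v / sg in Dv Hv *.
have pE : u = p * sg by rewrite divfK// gt_eqF.
have qE : v = q * sg by rewrite divfK// gt_eqF.
have p0 : 0 <= p by rewrite divr_ge0// ltW.
have q0 : 0 < q by rewrite divr_gt0.
have pq : p < q by rewrite ltr_pM2r ?invr_gt0.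
rewrite !normrN (ger0_norm p0) in Du Hu; rewrite !normrN (gtr0_norm q0) in Dv Hv.
have ke' := ke.
set A := (c - p) * (1 - c + p) in Du *; set B := (c - q) * (1 - c + q) in Dv *.
have [A1 A2] : 39 / 40 * k <= A /\ A <= 41 / 40 * k.
  by move: Du; rewrite ler_norml => /andP[? ?]; split; lra.
have [B1 B2] : 39 / 40 * k <= B /\ B <= 41 / 40 * k.
  by move: Dv; rewrite ler_norml => /andP[? ?]; split; lra.
have k0 : 0 < k by lra.
have k39 : 0 < 39 / 40 * k by exact: mulr_gt0.
have [A0 B0] : 0 < A /\ 0 < B.
  by split; [exact: lt_le_trans A1|exact: lt_le_trans B1].
rewrite pE qE.
have -> : (q * sg) ^+ 2 * k / B - (p * sg) ^+ 2 * k / A =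
    (q * sg - p * sg) * (k * (sg * (k * (q + p) - p * q * (1 - 2 * c)))) / (A * B).
  have BE : B = k - q * (1 - 2 * c) - q ^+ 2 by rewrite /B /k; ring.
  have AE : A = k - p * (1 - 2 * c) - p ^+ 2 by rewrite /A /k; ring.
  rewrite (_ : _ * (k * _) = (q * sg) ^+ 2 * k * A - (p * sg) ^+ 2 * k * B).
    by field; rewrite !gt_eqF.
  by rewrite BE AE; ring.
have pq0 : 0 <= p * q by rewrite mulr_ge0// ltW.
have pqk : p * q <= (q + p) * (k / 50).
  apply: (@le_trans _ _ ((q + p) * p)); first by nra.
  by rewrite ler_wpM2l ?addr_ge0// ?ltW//; lra.
have c2 : -1 <= 1 - 2 * c <= 1 by lra.
have tau : `|p * q * (1 - 2 * c)| <= (q + p) * (k / 50).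
  rewrite normrM (ger0_norm pq0) (le_trans _ pqk)// -[leRHS]mulr1 ler_wpM2l//.
  by rewrite ler_norml.
move: tau; rewrite ler_norml => /andP[tau1 tau2].
have AB0 : 0 < A * B by rewrite mulr_gt0.
have ABl : (39 / 40 * k) * (39 / 40 * k) <= A * B.
  by apply: ler_pM => //; exact: ltW.
have ABu : A * B <= (41 / 40 * k) * (41 / 40 * k).
  by apply: ler_pM => //; exact: ltW.
rewrite -[(q * sg - p * sg) * (k * _) / _]mulrA.
have W0 : 0 <= q * sg - p * sg by rewrite subr_ge0 ler_pM2r// ltW.
have qp0 : 0 <= (q + p) * sg by rewrite mulr_ge0// ?addr_ge0// ltW.
set M := k * _ / _.
suff [M1 M2] : (q + p) * sg / 2 <= M /\ M <= 2 * ((q + p) * sg).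
  apply/andP; split.
    have -> : (q * sg - p * sg) * (q * sg + p * sg) / 2 =
      (q * sg - p * sg) * ((q + p) * sg / 2) by ring.
    by rewrite ler_wpM2l.
  have -> : 2 * ((q * sg - p * sg) * (q * sg + p * sg)) =
    (q * sg - p * sg) * (2 * ((q + p) * sg)) by ring.
  by rewrite ler_wpM2l.
have kk : 0 < k * k by rewrite mulr_gt0.
split.
  rewrite /M ler_pdivlMr//.
  apply: (@le_trans _ _ ((q + p) * sg / 2 * (41 / 40 * k * (41 / 40 * k)))).
    by rewrite ler_wpM2l// divr_ge0.
  rewrite (_ : (q + p) * sg / 2 * _ = k * (sg * (k * (q + p) * (1681 / 3200)))); last by field.
  rewrite ler_wpM2l ?(ltW k0)// ler_wpM2l ?(ltW s_0)//.
  have : 0 <= k * (q + p) by rewrite mulr_ge0 ?(ltW k0)// addr_ge0// ltW.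
  by lra.
rewrite /M ler_pdivrMr//.
apply: (@le_trans _ _ (2 * ((q + p) * sg) * (39 / 40 * k * (39 / 40 * k)))); last first.
  by rewrite ler_wpM2l// mulr_ge0.
rewrite (_ : 2 * ((q + p) * sg) * _ = k * (sg * (k * (q + p) * (1521 / 800)))); last by field.
rewrite ler_wpM2l ?(ltW k0)// ler_wpM2l ?(ltW s_0)//.
have : 0 <= k * (q + p) by rewrite mulr_ge0 ?(ltW k0)// addr_ge0// ltW.
by lra.
Qed.

End estimates.

End rate_function.

(** * Parameters for the lower bound *)

Section slope_inverse.
Context {R : realType}.
Variables (e c sg : R).
Hypotheses (e0 : 0 < e) (ec : e <= c) (ce : c <= 1 - e) (sg0 : 0 < sg).

Let g := slope c sg.

Lemma slope_nonincreasing u v : 0 <= u -> u <= v -> v <= e / 100 * sg ->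
  g (- u) <= g (- v).
Proof.
move=> u0; rewrite le_eqVlt => /orP[/eqP->//|uv vB].
have /andP[H _] := slope_increment e0 ec ce sg0 u0 uv vB.
rewrite -subr_ge0; apply: le_trans H.
have v0 : 0 <= v by rewrite (le_trans u0)// ltW.
have vu0 : 0 <= v - u by rewrite subr_ge0 ltW.
by rewrite divr_ge0// mulr_ge0// addr_ge0.
Qed.

Lemma slope0 : g 0 = 0. Proof. by rewrite /g /slope expr0n/= !mul0r. Qed.

(** This is the point at which the exponent - (k + U) s - rate (- U) of
    Markov's inequality is stationary in U. *)
Lemma slope_solution s : 0 <= s -> s <= (e / 100 * sg / 20) ^+ 2 ->
  exists2 U, 0 <= U <= e / 100 * sg & g (- U) = s.
Proof.
move: (e0) (sg0) => e_0 s_0 s_ge s_le.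
pose B := e / 100 * sg.
have B0 : 0 < B by rewrite mulr_gt0// divr_gt0.
have cont : {within `[0, B], continuous (fun U => g (- U))}.
  apply: derivable_within_continuous => U; rewrite in_itv/= => /andP[U0 UB].
  have Ur : `|- U| <= e / 100 * sg by rewrite normrN ger0_norm.
  have /andP[d1 d2] := in_range e0 ec ce sg0 Ur.
  have dlin (p q : R) : derivable (fun x : R => p + q * x) U 1.
    apply: derivableD; first exact: derivable_cst.
    by apply: derivableM; [exact: derivable_cst|exact: derivable_id].
  rewrite (_ : (fun _ => _) = fun x : R => (0 + (c * (1 - c)) * x) * (0 + 1 * x) *
     ((c + - sg^-1 * x) * (1 - c + sg^-1 * x))^-1).
    apply: derivableM; first exact: derivableM.
    apply: derivableV; last exact: derivableM.
    rewrite mulf_neq0// gt_eqF//; move: d1 d2; rewrite !mulNr (mulrC sg^-1)//.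
    by lra.
  apply/funext => x; rewrite /g /slope; congr (_ / (_ * _)); [ring|ring|ring].
have gB : s <= g (- B).
  have := slope_increment e0 ec ce sg0 (lexx 0) B0 (lexx B).
  rewrite -/g subr0 addr0 oppr0 slope0 subr0 => /andP[H _]; apply: le_trans H.
  by apply: (le_trans s_le); rewrite -/B; have := sqr_ge0 B; lra.
have sin : Num.min (g (- 0)) (g (- B)) <= s <= Num.max (g (- 0)) (g (- B)).
  by rewrite oppr0 slope0 ge_min le_max s_ge gB orbT.
have [U + <-] := IVT (ltW B0) cont sin.
by rewrite in_itv/= => UB; exists U.
Qed.

End slope_inverse.

(** The parameters of the lower bound. With slope (- U) = s, the moment at the
    parameter V = U + 1 is carried by passage times above gamma + sigma s. As
    slope (- u) increases with u, passing from U to V changes the rate by more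
    than s, with a margin of order U, and passing from V to U + 2 changes it by
    less than s' - 3 for s' = slope (- (U + 2)) + 3: these are the parts below
    s and above s'. For the paths along the vertical axis, the level V^2 / 4
    and the parameter V / 2 leave a margin of order V^3, because the whole has
    exponent V^3 / 3. The margin 3 makes every part smaller by a factor 8, and
    400 <= s, which gives U >= 14, absorbs the lower order terms. *)
Lemma lower_tail_exponents (R : realType) (e c sg s k : R) :
    0 < e -> e <= c -> c <= 1 - e -> 0 < sg -> 400 <= s -> s <= (e / 100 * sg / 20) ^+ 2 ->
    `|k| <= 1 / 10 ->
  let f := rate c sg in exists U s' : R, let U1 := U + 1 in [/\ 10 <= U, U + 2 <= e / 100 * sg,
    s + f k - f (- U) <= f k - f (- U1) - 3,
    - s' + f k - f (- (U + 2)) <= f k - f (- U1) - 3 &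
    [/\ (k + U1) * (U1 ^+ 2 / 4) <= f k - f (- U1) - 3,
    - (U1 / 2 - k) * (U1 ^+ 2 / 4) + f (U1 / 2) - f (- U1) <= f k - f (- U1) - 3 &
    (k + U1) * s' - (f k - f (- U1)) + 1 <=
      2 * (Num.sqrt s) ^+ 3 / 3 + 70 * s + 20 / e * (s ^+ 2 / sg)]].
Proof.
move=> e0 ec ce sg0 s400 s_le k_le f; pose g := slope c sg.
have g0 : g 0 = 0 by exact: slope0.
have gmono u v : 0 <= u -> u <= v -> v <= e / 100 * sg -> g (- u) <= g (- v).
  exact: slope_nonincreasing.
have s0 : 0 <= s by lra.
have [U /andP[U0 UB] gU] := slope_solution e0 ec ce sg0 s0 s_le.
rewrite -/g in gU.
set q := Num.sqrt s.
have q0 : 0 <= q by exact: sqrtr_ge0.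
have qE : q ^+ 2 = s by exact: sqr_sqrtr.
have q20 : 20 <= q by rewrite -(@ler_pXn2r _ 2)// ?nnegrE// qE; lra.
pose B := e / 100 * sg.
have B0 : 0 < B by rewrite mulr_gt0// divr_gt0.
have qB : 20 * q <= B.
  have B20 : 0 <= B / 20 by rewrite divr_ge0// ltW.
  suff : q <= B / 20 by lra.
  by rewrite -(@ler_pXn2r _ 2)// ?nnegrE// qE.
have Upos : 0 < U.
  rewrite lt_neqAle U0 andbT; apply/negP => /eqP UE.
  by move: gU; rewrite -UE oppr0 g0 => s00; lra.
have [gl gu] : U ^+ 2 / 2 <= s /\ s <= 2 * U ^+ 2.
  have := slope_increment e0 ec ce sg0 (lexx 0) Upos UB.
  rewrite -/g subr0 addr0 oppr0 g0 gU subr0 -expr2 => /andP[? ?].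
  by split.
have U14 : 14 <= U.
  by rewrite -(@ler_pXn2r _ 2)// ?nnegrE//; lra.
have Uq : U <= 3 / 2 * q.
  rewrite -(@ler_pXn2r _ 2)// ?nnegrE ?mulr_ge0//.
  by rewrite exprMn qE; lra.
have U2B : U + 2 <= 2 * q by lra.
have U2r : U + 2 <= B by lra.
have mvt u v : 0 <= u -> u < v -> v <= B ->
    g (- u) * (v - u) <= f (- u) - f (- v) <= g (- v) * (v - u).
  move=> u0 uv vB.
  have vr : `|- v| <= e / 100 * sg by rewrite normrN ger0_norm//; lra.
  have ur : `|- u| <= e / 100 * sg by rewrite normrN ger0_norm//; rewrite -/B; lra.
  have /andP[v1 v2] := in_range e0 ec ce sg0 vr.
  have /andP[u1 u2] := in_range e0 ec ce sg0 ur.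
  have vu : - v < - u by rewrite ltrN2.
  have [x /andP[x1 x2]] := rate_MVT sg0 vu v1 u2.
  rewrite -/f -/g => ->.
  have -> : - u - - v = v - u by ring.
  have vu0 : 0 <= v - u by rewrite subr_ge0 ltW.
  have xu : u <= - x by rewrite lerNr ltW.
  have xv : - x <= v by rewrite lerNl ltW.
  by rewrite !ler_wpM2r// -[x]opprK gmono// ?(le_trans u0)//; exact: le_trans vB.
have cube u : `|u| <= B -> `|f u - u ^+ 3 / 3| <= 5 / e * (u ^+ 4 / sg).
  by move=> uB; exact: rate_near_cube.
have Ce0 : 0 <= 5 / e / sg by rewrite !divr_ge0// ltW.
pose V := U + 1.
have V15 : 15 <= V by rewrite /V; lra.
have CV : 5 / e * (V / sg) <= 1 / 200.
  have -> : 5 / e * (V / sg) = V / B / 20 by rewrite /B; field; rewrite !gt_eqF.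
  have : V / B <= 1 / 10 by rewrite ler_pdivrMr// /V; lra.
  by lra.
have Csg : 5 / e / sg <= 1 / 200.
  apply: le_trans CV; have -> : 5 / e * (V / sg) = 5 / e / sg * V by ring.
  by rewrite -[leLHS]mulr1 ler_wpM2l//; lra.
have V3 : 15 * V ^+ 2 <= V ^+ 3 by rewrite (exprS V 2) ler_wpM2r// sqr_ge0.
have V2 : 225 <= V ^+ 2.
  by rewrite (_ : 225 = 15 ^+ 2) ?lerXn2r ?nnegrE//; [lra|ring].
have err4 u : 0 <= u -> u <= V -> 5 / e * (u ^+ 4 / sg) <= u ^+ 3 / 200.
  move=> u_ge uV.
  have -> : 5 / e * (u ^+ 4 / sg) = u ^+ 3 * (5 / e * (u / sg)) by rewrite (exprSr u 3); ring.
  rewrite mulrC [leRHS]mulrC ler_wpM2r ?exprn_ge0//.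
  apply: le_trans (_ : 5 / e * (V / sg) <= _); last by lra.
  by rewrite ler_wpM2l ?divr_ge0 ?(ltW e0)// ler_wpM2r ?invr_ge0// ltW.
have k2 : k ^+ 2 <= 1 / 100.
  rewrite -real_normK ?num_real// (_ : 1 / 100 = (1 / 10) ^+ 2); last by field.
  by rewrite lerXn2r// nnegrE//; lra.
have /andP[k_l k_u] : - (1 / 10) <= k <= 1 / 10 by rewrite -ler_norml.
have kB : `|k| <= B by move: k_le qB q20; clear; lra.
have fk : -1 <= f k.
  have := cube _ kB; rewrite ler_norml => /andP[H _].
  have H4 : 5 / e * (k ^+ 4 / sg) <= 1 / 200.
    have -> : 5 / e * (k ^+ 4 / sg) = 5 / e / sg * (k ^+ 2 * k ^+ 2) by ring.
    rewrite -[leRHS]mulr1; apply: ler_pM => //; first by rewrite mulr_ge0 ?sqr_ge0.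
    by move: k2 (sqr_ge0 k); clear; nra.
  have k3 : - (1 / 1000) <= k ^+ 3.
    by rewrite (exprS k 2); move: k_l k2 (sqr_ge0 k); clear; nra.
  by move: H H4 k3; clear; lra.
have V0 : 0 <= V by move: V15; clear; lra.
have VB : V <= B by move: U2r; rewrite /V; clear; lra.
have fV : f (- V) <= - (V ^+ 3) / 3 + V ^+ 3 / 200.
  have nV : `|- V| <= B by rewrite normrN ger0_norm.
  have := cube _ nV; rewrite ler_norml => /andP[_].
  rewrite (_ : (- V) ^+ 4 = V ^+ 4); last by ring.
  rewrite (_ : (- V) ^+ 3 = - (V ^+ 3)); last by ring.
  by move: (err4 _ V0 (lexx V)); clear; lra.
have fV2 : f (V / 2) <= V ^+ 3 / 24 + V ^+ 3 / 200.
  have V20 : 0 <= V / 2 by move: V0; clear; lra.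
  have V2V : V / 2 <= V by move: V0; clear; lra.
  have nV : `|V / 2| <= B by rewrite ger0_norm//; exact: le_trans VB.
  have := cube _ nV; rewrite ler_norml => /andP[_].
  have := err4 _ V20 V2V.
  rewrite (_ : (V / 2) ^+ 3 = V ^+ 3 / 8); last by field.
  by move: (exprn_ge0 3 V0); clear; lra.
have drop : s + U / 4 <= f (- U) - f (- V).
  have Uh : U < U + 1 / 2 by clear; lra.
  have hV : U + 1 / 2 < V by rewrite /V; clear; lra.
  have Uh0 : 0 <= U + 1 / 2 by move: U0; clear; lra.
  have UhB : U + 1 / 2 <= B by exact: le_trans (ltW hV) VB.
  have /andP[m1 _] := mvt _ _ U0 Uh UhB.
  have /andP[m2 _] := mvt _ _ Uh0 hV VB.
  have := slope_increment e0 ec ce sg0 U0 Uh UhB; rewrite -/g gU => /andP[m3 _].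
  rewrite gU in m1.
  have E1 : U + 1 / 2 - U = 1 / 2 by ring.
  have E2 : V - (U + 1 / 2) = 1 / 2 by rewrite /V; field.
  rewrite E1 in m1 m3; rewrite E2 in m2.
  by move: m1 m2 m3; clear; lra.
have top : f (- V) - f (- (U + 2)) <= g (- (U + 2)).
  have VU : V < U + 2 by rewrite /V; clear; lra.
  have /andP[_] := mvt _ _ V0 VU U2r.
  have -> : U + 2 - V = 1 by rewrite /V; ring.
  by rewrite mulr1.
have g2 : g (- (U + 2)) <= s + 8 * U + 8.
  have UU : U < U + 2 by clear; lra.
  have := slope_increment e0 ec ce sg0 U0 UU U2r; rewrite -/g gU => /andP[_].
  rewrite (_ : U + 2 - U = 2); last by ring.
  by clear; lra.
have fU : f (- U) <= - (U ^+ 3) / 3 + 20 / e * (s ^+ 2 / sg).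
  have nU : `|- U| <= B by rewrite normrN ger0_norm.
  have := cube _ nU; rewrite ler_norml => /andP[_].
  rewrite (_ : (- U) ^+ 4 = U ^+ 4); last by ring.
  rewrite (_ : (- U) ^+ 3 = - (U ^+ 3)); last by ring.
  have U4 : 5 / e * (U ^+ 4 / sg) <= 20 / e * (s ^+ 2 / sg).
    have -> : 20 / e * (s ^+ 2 / sg) = 5 / e / sg * (4 * s ^+ 2) by ring.
    have -> : 5 / e * (U ^+ 4 / sg) = 5 / e / sg * U ^+ 4 by ring.
    rewrite ler_wpM2l// (_ : 4 * s ^+ 2 = (2 * s) ^+ 2); last by ring.
    have s20 : 0 <= 2 * s by exact: mulr_ge0.
    have Us : U ^+ 2 <= 2 * s by move: gl; clear; lra.
    by rewrite (exprM U 2 2) lerXn2r ?nnegrE ?sqr_ge0.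
  by move: U4; clear; lra.
have V3' : 0 <= V ^+ 3 by exact: exprn_ge0.
exists U; exists (g (- (U + 2)) + 3); rewrite /= -/V; split => //.
- by move: U14; clear; lra.
- by move: drop fk U14; clear; lra.
- by move: top; clear; lra.
split.
- have : k * V ^+ 2 <= 1 / 10 * V ^+ 2 by rewrite ler_wpM2r// sqr_ge0.
  rewrite (_ : (k + V) * (V ^+ 2 / 4) = k * V ^+ 2 / 4 + V ^+ 3 / 4); last by field.
  by move: fV fk V2 V3; clear; lra.
- have : k * V ^+ 2 <= 1 / 10 * V ^+ 2 by rewrite ler_wpM2r// sqr_ge0.
  rewrite (_ : - (V / 2 - k) * (V ^+ 2 / 4) = k * V ^+ 2 / 4 - V ^+ 3 / 8); last by field.
  by move: fV2 fV fk V2 V3; clear; lra.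
have s'0 : 0 <= g (- (U + 2)) + 3.
  have UU : U <= U + 2 by clear; lra.
  by have := gmono _ _ U0 UU U2r; rewrite gU; move: s0; clear; lra.
have c1 : (k + V) * (g (- (U + 2)) + 3) <= (U + 11 / 10) * (s + 8 * U + 11).
  apply: ler_pM => //.
  - by move: V15 k_l; clear; lra.
  - by move: k_u; rewrite /V; clear; lra.
  - by move: g2; clear; lra.
have US : 14 * U <= U ^+ 2 by rewrite expr2 ler_wpM2r.
(* The maximum of s U - U^3 / 3 over U >= 0 is attained at q. *)
have c2 : U * s - U ^+ 3 / 3 <= 2 * q ^+ 3 / 3.
  have -> : s = q ^+ 2 by [].
  have : 0 <= (q - U) ^+ 2 * (2 * q + U) by rewrite mulr_ge0 ?sqr_ge0//; move: q0 U0; clear; lra.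
  by rewrite (_ : (q - U) ^+ 2 * (2 * q + U) = 2 * q ^+ 3 - 3 * U * q ^+ 2 + U ^+ 3); [clear; lra|ring].
have c3 : (U + 11 / 10) * (s + 8 * U + 11) =
    U * s + 8 * U ^+ 2 + 11 * U + 11 / 10 * s + 88 / 10 * U + 121 / 10 by field.
by move: c1 c2 c3 US fU fk fV gl gu drop top g2 U14 s400; clear; lra.
Qed.

(** * The shape functions in a cone *)

Section shape_facts.
Context {R : realType}.
Variables (x y : R).
Hypotheses (x0 : 0 < x) (y0 : 0 < y).

Let sx : 0 < Num.sqrt x. Proof. by rewrite sqrtr_gt0. Qed.
Let sy : 0 < Num.sqrt y. Proof. by rewrite sqrtr_gt0. Qed.
Let S0 : 0 < Num.sqrt x + Num.sqrt y. Proof. exact: addr_gt0. Qed.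
Let sxE : Num.sqrt x ^+ 2 = x. Proof. by rewrite sqr_sqrtr// ltW. Qed.
Let syE : Num.sqrt y ^+ 2 = y. Proof. by rewrite sqr_sqrtr// ltW. Qed.

(** Both coordinates are squares times gamma: this turns the two logarithms in
    [boundary_mgf] into [entropy], and sigma^3 into the prefactor of
    [rate]. *)
Lemma gamma_zeta_sqr : x = gamma x y * zeta x y ^+ 2.
Proof.
rewrite /gamma /zeta expr_div_n sxE mulrCA divff ?mulr1//.
by rewrite gt_eqF// exprn_gt0.
Qed.

Lemma zetaC : 1 - zeta x y = Num.sqrt y / (Num.sqrt x + Num.sqrt y).
Proof. by rewrite /zeta; field; rewrite gt_eqF. Qed.

Lemma gamma_zetaC_sqr : y = gamma x y * (1 - zeta x y) ^+ 2.
Proof.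
rewrite zetaC /gamma expr_div_n syE mulrCA divff ?mulr1//.
by rewrite gt_eqF// exprn_gt0.
Qed.

Lemma sigma_gt0 : 0 < sigma x y.
Proof. by rewrite /sigma divr_gt0 ?mulr_gt0 ?powR_gt0. Qed.

Lemma sigma_cube : gamma x y = zeta x y * (1 - zeta x y) * sigma x y ^+ 3.
Proof.
have p3 (a : R) (p : R) : (a `^ p) ^+ 3 = a `^ (p * 3%:R).
  by rewrite powRrM powR_mulrn// powR_ge0.
have half (a : R) : 0 < a -> (a `^ (1 / 6)) ^+ 3 = Num.sqrt a.
  move=> a0; rewrite p3 (_ : 1 / 6 * 3%:R = 2^-1); last by field.
  by rewrite powR12_sqrt// ltW.
rewrite zetaC /sigma expr_div_n exprMn !half// p3.
rewrite (_ : 4 / 3 * 3%:R = 4%:R); last by field.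
rewrite powR_mulrn ?(ltW S0)// /gamma /zeta.
by field; rewrite !gt_eqF.
Qed.

Lemma gamma_bounds : x + y <= gamma x y <= 2 * (x + y).
Proof.
have gE : gamma x y = x + y + 2 * (Num.sqrt x * Num.sqrt y).
  by rewrite /gamma sqrrD sxE syE; ring.
have p0 : 0 <= Num.sqrt x * Num.sqrt y by rewrite mulr_ge0// ltW.
have p2 : 2 * (Num.sqrt x * Num.sqrt y) <= x + y.
  have := sqr_ge0 (Num.sqrt x - Num.sqrt y).
  rewrite (_ : _ ^+ 2 = x + y - 2 * (Num.sqrt x * Num.sqrt y)); first by lra.
  by rewrite sqrrB sxE syE; ring.
by rewrite gE; apply/andP; split; lra.
Qed.

Lemma cone_zeta delta : 0 < delta -> delta * y <= x -> delta * x <= y ->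
  let e := Num.sqrt delta / (1 + Num.sqrt delta) in
  [/\ 0 < e, e <= zeta x y & zeta x y <= 1 - e].
Proof.
move=> d0 dx dy e.
have sd : 0 < Num.sqrt delta by rewrite sqrtr_gt0.
have d1 : 0 < 1 + Num.sqrt delta by rewrite addr_gt0.
have hx : Num.sqrt delta * Num.sqrt y <= Num.sqrt x.
  by rewrite -sqrtrM ?(ltW d0)// ler_wsqrtr.
have hy : Num.sqrt delta * Num.sqrt x <= Num.sqrt y.
  by rewrite -sqrtrM ?(ltW d0)// ler_wsqrtr.
split; first by rewrite divr_gt0.
  rewrite /e /zeta ler_pdivrMr// mulrAC ler_pdivlMr//.
  by rewrite mulrDr mulrDr mulr1 (mulrC (Num.sqrt x)) [leRHS]addrC lerD2l.
rewrite lerBrDr -lerBrDl zetaC /e ler_pdivrMr// mulrAC ler_pdivlMr//.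
by rewrite mulrDr mulrDr mulr1 (mulrC (Num.sqrt y)) lerD2r.
Qed.

(** The bounds follow from sigma^3 = gamma / (c (1 - c)), where gamma is
    comparable to x + y and c (1 - c) lies between e / 2 and 1. *)
Lemma sigma_bounds e : 0 < e -> e <= zeta x y -> zeta x y <= 1 - e ->
  (x + y) `^ (1 / 3) <= sigma x y <= 4 / e * (x + y) `^ (1 / 3).
Proof.
move=> e0 ez ze; have /andP[gl gu] := gamma_bounds.
have sg0 := sigma_gt0; have sE := sigma_cube.
set c := zeta x y in ez ze sE; set k := c * (1 - c) in sE.
have ke : e / 2 <= k.
  have h1 : 0 <= (c - e) * (1 - e - c) by rewrite mulr_ge0//; lra.
  have h2 : 0 <= e * (1 / 2 - e) by rewrite mulr_ge0//; lra.
  by rewrite /k; lra.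
have k1 : k <= 1 by rewrite /k; have := sqr_ge0 (c - 1 / 2); lra.
have N0 : 0 <= x + y by rewrite addr_ge0// ltW.
have r3 : ((x + y) `^ (1 / 3)) ^+ 3 = x + y.
  rewrite -powR_mulrn ?powR_ge0// -powRrM (_ : 1 / 3 * 3%:R = 1); last by field.
  by rewrite powRr1.
have r0 : 0 <= (x + y) `^ (1 / 3) by exact: powR_ge0.
have s3 : 0 < sigma x y ^+ 3 by exact: exprn_gt0.
have cube_le (a b : R) : 0 <= a -> 0 <= b -> a ^+ 3 <= b ^+ 3 -> a <= b.
  by move=> a0 b0; rewrite ler_pXn2r.
apply/andP; split.
  apply: cube_le => //; first exact: ltW.
  rewrite r3; apply: (le_trans gl).
  by rewrite sE -[leRHS]mul1r ler_wpM2r// ltW.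
have e40 : 0 <= 4 / e by rewrite divr_ge0// ltW.
apply: cube_le; [exact: ltW|exact: mulr_ge0|rewrite [leRHS]exprMn r3].
have e41 : 1 <= 4 / e by rewrite ler_pdivlMr// mul1r; lra.
apply: (@le_trans _ _ (4 / e * (x + y))).
  rewrite mulrAC ler_pdivlMr//.
  have : e / 2 * sigma x y ^+ 3 <= 2 * (x + y).
    by apply: le_trans gu; rewrite sE ler_wpM2r// ltW.
  by lra.
rewrite ler_wpM2r// (exprS _ 2) -[leLHS]mulr1 ler_wpM2l//.
by rewrite expr2 -[leLHS]mulr1 ler_pM.
Qed.

End shape_facts.

(** For parameters near the critical point c the exponential moment is the
    exponential of a linear term and of a difference of values of [rate]: the
    two axes decouple. *)
Lemma boundary_mgfE (R : realType) (m n : nat) (c sg G e u v : R) :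
    0 < e -> e <= c -> c <= 1 - e -> 0 < sg ->
    m%:R = G * c ^+ 2 -> n%:R = G * (1 - c) ^+ 2 -> G = c * (1 - c) * sg ^+ 3 ->
    `|u| <= e / 100 * sg -> `|v| <= e / 100 * sg ->
  boundary_mgf m n (c + u / sg) (1 - c - v / sg) =
  expR (G * ((u - v) / sg) + (rate c sg u - rate c sg v)).
Proof.
move=> e0 ec ce sg0 mE nE GE ur vr.
have /andP[u0 u1] := in_range e0 ec ce sg0 ur.
have /andP[v0 v1] := in_range e0 ec ce sg0 vr.
have u1' : 0 < 1 - c - u / sg by lra.
have v1' : 0 < 1 - c - v / sg by lra.
have ratio (a b : R) : 0 < a -> 0 < b -> a / b = expR (ln a - ln b).
  by move=> a0 b0; rewrite expRB !lnK.
rewrite /boundary_mgf.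
rewrite (_ : 1 - (1 - c - v / sg) = c + v / sg); last by ring.
rewrite (_ : 1 - (c + u / sg) = 1 - c - u / sg); last by ring.
rewrite (ratio (c + u / sg) (c + v / sg))//.
rewrite (ratio (1 - c - v / sg) (1 - c - u / sg))// -!expRM_natl -expRD mE nE; congr expR.
rewrite /rate -GE /entropy.
rewrite (_ : 1 - (c + u / sg) = 1 - c - u / sg); last by ring.
rewrite (_ : 1 - (c + v / sg) = 1 - c - v / sg); last by ring.
by ring.
Qed.

(** * Tail estimates at the characteristic direction *)

Section tail_bounds.
Context d (T : measurableType d) (R : realType) (P : probability T R).
Variables (z : R) (w : nat * nat -> {RV P >-> R}) (m n : nat) (e c sg G k : R).
Hypothesis z01 : 0 < z < 1.
Hypothesis wz : increment_stationary_weights z w.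
Hypotheses (e0 : 0 < e) (ec : e <= c) (ce : c <= 1 - e) (sg0 : 0 < sg).
Hypotheses (mE : m%:R = G * c ^+ 2) (nE : n%:R = G * (1 - c) ^+ 2).
Hypothesis GE : G = c * (1 - c) * sg ^+ 3.
Hypotheses (zE : z = c + k / sg) (kB : `|k| <= e / 100 * sg).

Let f := rate c sg.
Let sgn0 : sg != 0. Proof. by rewrite gt_eqF. Qed.
Let zE' : 1 - z = 1 - c - k / sg. Proof. by rewrite zE opprD addrA. Qed.
Let mgfE u v := @boundary_mgfE R m n c sg G e u v e0 ec ce sg0 mE nE GE.
Let ltdiv u v : (u / sg < v / sg) = (u < v).
Proof. by rewrite ltr_pM2r// invr_gt0. Qed.

Let range u : `|u| <= e / 100 * sg -> 0 < c + u / sg < 1.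
Proof. exact: in_range. Qed.

(** The leading exponent q^3 / 3 - q s of both halves of [Ghat_tail_le] is
    minimal at q = sqrt s, with value - 2 q^3 / 3. The parameter k contributes
    |k| s directly; its own cubic term is at most as large, since |k| < q. *)
Lemma upper_tail s : let q := Num.sqrt s in
    0 <= s -> `|k| < q -> q <= e / 100 * sg ->
  (P [set t | (G + sg * s <= Ghat w m n t)%R] <=
   (2 * expR (- (2 * q ^+ 3 / 3) + 2 * `|k| * s + 5 / e * (s ^+ 2 / sg)))%:E)%E.
Proof.
move=> q s0 kq qB; move: (e0) (sg0) => e_0 sg_0.
have q0 : 0 <= q by exact: sqrtr_ge0.
have qE : q ^+ 2 = s by exact: sqr_sqrtr.
have /andP[kq1 kq2] : - q < k < q by rewrite -ltr_norml.
have nq : `|q| <= e / 100 * sg by rewrite ger0_norm.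
have nNq : `|- q| <= e / 100 * sg by rewrite normrN ger0_norm.
have /andP[q1 q2] := range nq; have /andP[q3 q4] := range nNq.
have a01 : z < c + q / sg < 1 by rewrite zE ltrD2l ltdiv kq2.
have b01 : 1 - z < 1 - c - (- q) / sg < 1.
  by rewrite zE' ltrD2l ltrN2 ltdiv kq1/= -addrA -opprD ltrBlDr ltrDl.
have := @Ghat_tail_le _ _ _ P z w m n z01 wz _ _ (G + sg * s) a01 b01.
move=> /le_trans; apply; rewrite lee_fin zE' zE !mgfE// -!expRD.
set A := (X in _ <= 2 * expR X).
have cube u : `|u| <= e / 100 * sg -> `|f u - u ^+ 3 / 3| <= 5 / e * (u ^+ 4 / sg).
  by move=> uB; exact: rate_near_cube.
have := cube _ nq; rewrite ler_norml => /andP[_ fq].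
have := cube _ nNq; rewrite ler_norml => /andP[fNq _].
have := cube _ kB; rewrite ler_norml => /andP[fk1 fk2].
have q4E : q ^+ 4 = s ^+ 2 by rewrite -qE; ring.
have Nq4E : (- q) ^+ 4 = s ^+ 2 by rewrite -qE; ring.
have Nq3E : (- q) ^+ 3 = - q ^+ 3 by ring.
have q3E : q * s = q ^+ 3 by rewrite -qE; ring.
rewrite q4E in fq; rewrite Nq4E Nq3E in fNq.
have ks : `|k| ^+ 3 <= `|k| * s.
  by rewrite exprS ler_wpM2l// -qE lerXn2r ?nnegrE// ltW.
have k3 : `|k ^+ 3| <= `|k| * s by rewrite normrX.
have k4 : 5 / e * (k ^+ 4 / sg) <= `|k| * s / 20.
  have -> : k ^+ 4 = `|k| ^+ 3 * `|k|.
    by rewrite -exprSr -normrX ger0_norm// (exprM k 2 2) sqr_ge0.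
  have -> : 5 / e * (`|k| ^+ 3 * `|k| / sg) = `|k| ^+ 3 * (`|k| / (e / 100 * sg)) / 20.
    by field; rewrite !gt_eqF.
  have B0 : 0 < e / 100 * sg by rewrite mulr_gt0// divr_gt0.
  have r0 : 0 <= `|k| / (e / 100 * sg) by rewrite divr_ge0// ltW.
  have r1 : `|k| / (e / 100 * sg) <= 1 by rewrite ler_pdivrMr// mul1r.
  by rewrite ler_wpM2r// -[leRHS]mulr1; apply: ler_pM => //; exact: exprn_ge0.
have /andP[ks1 ks2] : - (`|k| * s) <= k * s <= `|k| * s.
  by rewrite -ler_norml normrM (ger0_norm s0).
have /andP[k31 k32] : - (`|k| * s) <= k ^+ 3 <= `|k| * s by rewrite -ler_norml.
have ks0 : 0 <= `|k| * s by rewrite mulr_ge0.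
have E1 : - (c + k / sg + (1 - c - - q / sg) - 1) * (G + sg * s) +
    (G * ((k - - q) / sg) + (f k - f (- q))) = - (k * s) - q ^+ 3 + f k - f (- q).
  by rewrite -q3E; field.
have E2 : - (c + q / sg - (c + k / sg)) * (G + sg * s) +
    (G * ((q - k) / sg) + (f q - f k)) = k * s - q ^+ 3 + f q - f k.
  by rewrite -q3E; field.
rewrite E1 E2 (_ : 2 * expR A = expR A + expR A); last by ring.
apply: lerD; rewrite ler_expR /A.
- by lra.
- by lra.
Qed.

Let expR_main (t u : R) : u <= t - 3 -> expR u <= expR t / 8.
Proof.
move=> ut; have e8 : 8 <= expR 3 :> R.
  rewrite (_ : 3 = 1 * 3%:R :> R); last by rewrite mul1r.
  rewrite expRM_natr (_ : 8 = 2 ^+ 3 :> R); last by ring.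
  have e2 := expR_ge1Dx (1 : R).
  by rewrite lerXn2r ?nnegrE ?expR_ge0.
rewrite ler_pdivlMr//; apply: (@le_trans _ _ (expR u * expR 3)).
  by rewrite ler_wpM2l// expR_ge0.
by rewrite -expRD ler_expR; lra.
Qed.

(** In [Ghat_tail_ge] all terms share the factor exp (G (k + V) / sg); without
    it their exponents are those of [lower_tail_exponents]. Four terms are at
    most an eighth of the left-hand side, and the resulting factor 1 / 2 is
    absorbed as exp (- 1). *)
Lemma lower_tail s : 400 <= s -> s <= (e / 100 * sg / 20) ^+ 2 -> `|k| <= 1 / 10 ->
  expR (- (2 * Num.sqrt s ^+ 3 / 3) - 70 * s - 20 / e * (s ^+ 2 / sg)) <=
  fine (P [set t | (G + sg * s <= Ghat w m n t)%R]).
Proof.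
move=> s400 s_le k_le; move: (e0) (sg0) => e_0 sg_0.
have four_eighths (X Y t1 t3 t4 t5 : R) : X <= t1 + Y + t3 + t4 + t5 ->
    t1 <= X / 8 -> t3 <= X / 8 -> t4 <= X / 8 -> t5 <= X / 8 -> X <= 2 * Y.
  by lra.
have [U [s' /=]] := lower_tail_exponents e0 ec ce sg0 s400 s_le k_le.
set V := U + 1; rewrite -/f => -[U10 UB h1 h3 [h4 h5 h2]].
set p := fine _; set M := f k - f (- V) in h1 h2 h3 h4 h5.
have /andP[k1 k2] : - (1 / 10) <= k <= 1 / 10 by rewrite -ler_norml.
have nU u : 0 <= u -> u <= U + 2 -> `|- u| <= e / 100 * sg.
  by move=> u0 uU; rewrite normrN ger0_norm// (le_trans uU).
have VE : V = U + 1 by [].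
have [Uk kV] : - U < k /\ k < V / 2 by split; lra.
have [U0 UU2] : 0 <= U /\ U <= U + 2 by split; lra.
have [V0 VU2] : 0 <= V /\ V < U + 2 by split; lra.
have [Vh0 VhU] : 0 <= V / 2 /\ V / 2 <= U + 2 by split; lra.
have UV : U < V by rewrite VE ltrDl.
have nV := nU V V0 (ltW VU2).
have nU0 := nU U U0 UU2.
have nU2 := nU (U + 2) (le_trans U0 UU2) (lexx _).
have nVh : `|V / 2| <= e / 100 * sg by rewrite -normrN; exact: nU.
have /andP[Vh1 Vh2] := range nVh.
have /andP[U21 U22] := range nU2.
have a01 : z < c + V / 2 / sg < 1 by rewrite zE ltrD2l ltdiv kV.
have b1 : 1 - z < 1 - c - (- U) / sg.
  by rewrite zE' ltrD2l ltrN2 ltdiv.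
have b2 : 1 - c - (- U) / sg < 1 - c - (- V) / sg.
  by rewrite ltrD2l ltrN2 ltdiv ltrN2.
have b3 : 1 - c - (- V) / sg < 1 - c - (- (U + 2)) / sg.
  by rewrite ltrD2l ltrN2 ltdiv ltrN2.
have b4 : 1 - c - (- (U + 2)) / sg < 1.
  by rewrite -addrA -opprD ltrBlDr ltrDl.
have := @Ghat_tail_ge _ _ _ P z w m n z01 wz _ _ _ _ (G + sg * s) (G + sg * s')
  (G + sg * (V ^+ 2 / 4)) a01 b1 b2 b3 b4.
rewrite zE !mgfE// -!expRD -/p -/f.
set E := G * ((k + V) / sg).
rewrite (_ : G * ((k - - V) / sg) + (f k - f (- V)) = E + M); last first.
  by rewrite /E opprK.
have e1 : (1 - c - - V / sg - (1 - c - - U / sg)) * (G + sg * s) +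
    (G * ((k - - U) / sg) + (f k - f (- U))) <= E + M - 3.
  rewrite [leLHS](_ : _ = E + (s + f k - f (- U))); last first.
    by rewrite /E VE; field.
  by rewrite -[leRHS]addrA lerD2l.
have e2 : (c + k / sg + (1 - c - - V / sg) - 1) * (G + sg * s') = E + (k + V) * s'.
  by rewrite /E; field.
have e3 : - (1 - c - - (U + 2) / sg - (1 - c - - V / sg)) * (G + sg * s') +
    (G * ((k - - (U + 2)) / sg) + (f k - f (- (U + 2)))) <= E + M - 3.
  rewrite [leLHS](_ : _ = E + (- s' + f k - f (- (U + 2)))); last first.
    by rewrite /E VE; field.
  by rewrite -[leRHS]addrA lerD2l.
have e4 : (c + k / sg + (1 - c - - V / sg) - 1) * (G + sg * (V ^+ 2 / 4)) <= E + M - 3.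
  rewrite [leLHS](_ : _ = E + (k + V) * (V ^+ 2 / 4)); last by rewrite /E; field.
  by rewrite -[leRHS]addrA lerD2l.
have e5 : - (c + V / 2 / sg - (c + k / sg)) * (G + sg * (V ^+ 2 / 4)) +
    (G * ((V / 2 - - V) / sg) + (f (V / 2) - f (- V))) <= E + M - 3.
  rewrite [leLHS](_ : _ = E + (- (V / 2 - k) * (V ^+ 2 / 4) + f (V / 2) - f (- V))); last first.
    by rewrite /E; field.
  by rewrite -[leRHS]addrA lerD2l.
rewrite e2 => main.
have {main} : expR (E + M) <= 2 * (expR (E + (k + V) * s') * p).
  exact: four_eighths main (expR_main e1) (expR_main e3) (expR_main e4) (expR_main e5).
have e21 : 2 <= expR 1 :> R by exact: expR_ge1Dx.
move=> main; rewrite -(@ler_pM2l _ (expR (E + (k + V) * s' + 1))) ?expR_gt0//.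
rewrite -expRD [leRHS](_ : _ = expR 1 * (expR (E + (k + V) * s') * p)); last first.
  by rewrite expRD; ring.
apply: (@le_trans _ _ (expR (E + M))); first by rewrite ler_expR; lra.
apply: (le_trans main); rewrite ler_wpM2r//.
by rewrite mulr_ge0 ?expR_ge0// fine_ge0.
Qed.

End tail_bounds.

(** * Uniformity in the direction, and the theorem *)

Lemma powR_unbounded (R : realType) (p a : R) : 0 < p ->
  exists2 N0 : R, 0 < N0 & forall N, N0 <= N -> a <= N `^ p.
Proof.
move=> p0; pose b := `|a| + 1; have b0 : 0 < b by rewrite /b; have := normr_ge0 a; lra.
exists (b `^ p^-1); first exact: powR_gt0.
move=> N bN; have N0 : 0 <= N by apply: le_trans bN; exact: powR_ge0.
apply: (@le_trans _ _ b); first by rewrite (le_trans (ler_norm a))// lerDl.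
have -> : b = (b `^ p^-1) `^ p by rewrite -powRrM mulVf ?gt_eqF// powRr1// ltW.
by rewrite ge0_ler_powR ?nnegrE ?powR_ge0// ltW.
Qed.

Lemma powR32 (R : realType) (s : R) : 0 <= s -> s `^ (3 / 2) = Num.sqrt s ^+ 3.
Proof.
move=> s0; rewrite -powR12_sqrt// -powR_mulrn ?powR_ge0// -powRrM.
by congr (_ `^ _); field.
Qed.

(** In the scale of the rate function the assumption on z says that
    |k| = O (K / N^p), because sigma is of order N^(1/3). *)
Lemma admissible_scaling (R : realType) (delta K p : R) (m n : nat) (z : R) :
    0 < delta -> admissible delta K p m n z ->
  let e := Num.sqrt delta / (1 + Num.sqrt delta) in
  let c := zeta m%:R n%:R in let sg := sigma m%:R n%:R in
  let G := gamma m%:R n%:R in let k := sg * (z - c) in let N : R := m%:R + n%:R in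
  [/\ [/\ 0 < e, e <= c & c <= 1 - e],
    [/\ m%:R = G * c ^+ 2, n%:R = G * (1 - c) ^+ 2 & G = c * (1 - c) * sg ^+ 3],
    [/\ 0 < sg, 0 < N `^ (1 / 3), N `^ (1 / 3) <= sg & N `^ (2 / 3) <= sg ^+ 2],
    z = c + k / sg & 0 < N `^ p /\ `|k| <= 4 / e * (K / N `^ p)].
Proof.
move=> d0 [[m0 n0] [x0 y0 dx dy] z01 zK] e c sg G k N; rewrite /= in x0 y0 dx dy.
have [e0 ec ce] := cone_zeta x0 y0 d0 dx dy.
have sg0 : 0 < sg by exact: sigma_gt0.
have /andP[sl su] := sigma_bounds x0 y0 e0 ec ce.
have N0 : 0 < N by exact: addr_gt0.
have c0 : 0 < N `^ (1 / 3) by exact: powR_gt0.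
split => //.
- by split; [exact: gamma_zeta_sqr|exact: gamma_zetaC_sqr|exact: sigma_cube].
- split => //; rewrite (_ : 2 / 3 = 1 / 3 * 2%:R); last by field.
  by rewrite powRrM powR_mulrn ?powR_ge0// lerXn2r ?nnegrE ?(ltW c0) ?(ltW sg0).
- by rewrite /k; field; rewrite gt_eqF.
split; first exact: powR_gt0.
rewrite normrM (gtr0_norm sg0).
have zK' : `|z - c| <= K * ((N `^ (1 / 3))^-1 / N `^ p).
  have Nn : N != 0 by rewrite gt_eqF.
  by move: zK; rewrite -/N powRD ?Nn ?implybT// !powRN.
apply: (le_trans (ler_wpM2l (ltW sg0) zK')).
have KK : 0 <= K * ((N `^ (1 / 3))^-1 / N `^ p) by exact: le_trans zK'.
apply: (le_trans (ler_wpM2r KK su)); rewrite le_eqVlt; apply/orP; left.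
by apply/eqP; rewrite -/N -/e; field; rewrite !gt_eqF ?powR_gt0.
Qed.

Theorem theorem2p3 (R : realType) :
  (forall delta : R, 0 < delta ->
    exists C0 eps0 : R, [/\ 0 < C0, 0 < eps0 &
      forall K p s0 : R, 0 <= K -> 0 < p -> 0 < s0 ->
      exists N0 : R, 0 < N0 /\
        forall (m n : nat) (z : R), admissible delta K p m n z ->
        N0 <= m%:R -> N0 <= n%:R ->
        forall (d : measure_display) (T : measurableType d)
          (P : probability T R) (w : nat * nat -> {RV P >-> R}),
        increment_stationary_weights z w ->
        forall s : R, s0 <= s <= eps0 * (m%:R + n%:R) `^ (2 / 3) ->
        (lne (P [set t | (gamma m%:R n%:R + sigma m%:R n%:R * s
                          <= Ghat w m n t)%R])
         <= (- (2 * s `^ (3 / 2) / 3) + ln 2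
             + C0 * K * s / (m%:R + n%:R) `^ p
             + C0 * s ^+ 2 / (m%:R + n%:R) `^ (1 / 3))%:E)%E])
  /\
  (exists s1 eta : R, [/\ 0 < s1, 0 < eta &
    forall delta : R, 0 < delta ->
    exists C1 eps1 : R, [/\ 0 < C1, 0 < eps1 &
      forall K p : R, 0 <= K -> 0 < p ->
      exists N1 : R, 0 < N1 /\
        forall (m n : nat) (z : R), admissible delta K p m n z ->
        N1 <= m%:R -> N1 <= n%:R ->
        forall (d : measure_display) (T : measurableType d)
          (P : probability T R) (w : nat * nat -> {RV P >-> R}),
        increment_stationary_weights z w ->
        forall s : R, s1 <= s <= eps1 * (m%:R + n%:R) `^ (2 / 3) ->
        ((- (2 * s `^ (3 / 2) / 3) - eta * s
          - C1 * s ^+ 2 / (m%:R + n%:R) `^ (1 / 3))%:E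
         <= lne (P [set t | (gamma m%:R n%:R + sigma m%:R n%:R * s
                             <= Ghat w m n t)%R]))%E]]).
Proof.
have lneW (X : \bar R) (r : R) : (0 <= X)%E -> 0 < r -> (X <= r%:E)%E ->
    (lne X <= (ln r)%:E)%E.
  move=> X0 r0 Xr; rewrite -lne_EFin//.
  have X_in : X \in `[0%E, +oo%E] by rewrite in_itv/= X0 leey.
  have r_in : r%:E \in `[0%E, +oo%E] by rewrite in_itv/= leey andbT lee_fin ltW.
  by rewrite lee_lne.
have fineW (X : \bar R) (r : R) : 0 < r -> r <= fine X -> (r%:E <= X)%E.
  case: X => [x| |]/= r0 rX; rewrite ?lee_fin ?leey//.
  by move: r0; rewrite ltNge rX.
split=> [delta d0|].
  pose e := Num.sqrt delta / (1 + Num.sqrt delta).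
  have sd : 0 < Num.sqrt delta by rewrite sqrtr_gt0.
  have e0 : 0 < e by rewrite divr_gt0// addr_gt0.
  (* In 13 = 8 + 5 the first part comes from 2 |k| s and the second from the
     quartic error; the bound on s keeps sqrt s in the range of the cubic
     approximation. *)
  exists (13 / e), ((e / 100) ^+ 2); split; [exact: divr_gt0|by rewrite exprn_gt0// divr_gt0|].
  move=> K p s0 K0 p0 s00.
  (* This choice gives |k| <= sqrt s0 / 2 < sqrt s. *)
  have [N0 N00 hN0] := powR_unbounded (4 / e * K / (Num.sqrt s0 / 2)) p0.
  exists N0; split => // m n z adm mN nN d T P w wz s /andP[s0s ss].
  have [] := admissible_scaling d0 adm; rewrite -/e.
  set c := zeta _ _; set sg := sigma _ _; set G := gamma _ _.
  set k := sg * (z - c); set N : R := m%:R + n%:R.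
  move=> [_ ec ce] [mE nE GE] [sg0 c0 Nsg Nsg2] zE [Np0 kN].
  have z01 : 0 < z < 1 by case: adm.
  have qs0 : 0 < Num.sqrt s0 by rewrite sqrtr_gt0.
  have s_0 : 0 <= s by rewrite (le_trans _ s0s)// ltW.
  have kq : `|k| < Num.sqrt s.
    apply: (le_lt_trans kN); apply: (@lt_le_trans _ _ (Num.sqrt s0)); last exact: ler_wsqrtr.
    have NN : N0 <= N by rewrite (le_trans mN)// lerDl.
    have := hN0 _ NN; rewrite ler_pdivrMr ?divr_gt0// => KN.
    apply: (@le_lt_trans _ _ (Num.sqrt s0 / 2)); last by lra.
    by rewrite mulrA ler_pdivrMr// [leRHS]mulrC.
  have qB : Num.sqrt s <= e / 100 * sg.
    have B0 : 0 <= e / 100 * sg by rewrite ltW// mulr_gt0// divr_gt0.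
    rewrite -(@ler_pXn2r _ 2)// ?nnegrE ?sqrtr_ge0// sqr_sqrtr// exprMn.
    by apply: (le_trans ss); rewrite ler_wpM2l// sqr_ge0.
  have kB : `|k| <= e / 100 * sg by rewrite (le_trans (ltW kq)).
  have := upper_tail z01 wz e0 ec ce sg0 mE nE GE zE kB s_0 kq qB.
  set A := - _ + _ + _ => PA.
  have e2A : 0 < 2 * expR A by rewrite mulr_gt0// expR_gt0.
  apply: (le_trans (lneW _ _ (measure_ge0 _ _) e2A PA)); rewrite lee_fin.
  rewrite lnM ?posrE ?expR_gt0// expRK /A powR32//.
  have t1 : `|k| * s <= 4 / e * K * s / N `^ p.
    rewrite (_ : 4 / e * K * s / N `^ p = 4 / e * (K / N `^ p) * s); last by ring.
    exact: ler_wpM2r.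
  have t2 : s ^+ 2 / sg <= s ^+ 2 / N `^ (1 / 3).
    by rewrite ler_wpM2l ?sqr_ge0// lef_pV2 ?posrE.
  have t3 : 5 / e * (s ^+ 2 / sg) <= 5 / e * (s ^+ 2 / N `^ (1 / 3)).
    by rewrite ler_wpM2l// divr_ge0// ltW.
  have Y0 : 0 <= e^-1 * (s ^+ 2 / N `^ (1 / 3)).
    rewrite mulr_ge0 ?invr_ge0 ?(ltW e0)//.
    by rewrite divr_ge0 ?sqr_ge0 ?(ltW c0).
  have X0 : 0 <= e^-1 * K * s / N `^ p.
    by rewrite divr_ge0 ?(ltW Np0)// !mulr_ge0 ?invr_ge0 ?(ltW e0).
  lra.
exists 400, 70; split; [by rewrite ltr0n|by rewrite ltr0n|move=> delta d0].
pose e := Num.sqrt delta / (1 + Num.sqrt delta).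
have sd : 0 < Num.sqrt delta by rewrite sqrtr_gt0.
have e0 : 0 < e by rewrite divr_gt0// addr_gt0.
exists (20 / e), ((e / 100 / 20) ^+ 2); split; [exact: divr_gt0|by rewrite exprn_gt0// !divr_gt0|].
move=> K p K0 p0.
(* [N1] ensures |k| <= 1 / 10, and [N2] that this is in the range where the
   rate function is defined and controlled. *)
have [N1 N10 hN1] := powR_unbounded (4 / e * K / (1 / 10)) p0.
have [N2 N20 hN2] := @powR_unbounded R (1 / 3) (10 / e) ltac:(by []).
exists (Num.max N1 N2); split; first by rewrite lt_max N10.
move=> m n z adm mN nN d T P w wz s /andP[s400 ss].
have [] := admissible_scaling d0 adm; rewrite -/e.
set c := zeta _ _; set sg := sigma _ _; set G := gamma _ _.
set k := sg * (z - c); set N : R := m%:R + n%:R.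
move=> [_ ec ce] [mE nE GE] [sg0 c0 Nsg Nsg2] zE [Np0 kN].
have z01 : 0 < z < 1 by case: adm.
have NN : Num.max N1 N2 <= N by rewrite (le_trans mN)// lerDl.
have k10 : `|k| <= 1 / 10.
  apply: (le_trans kN); have := hN1 N; rewrite ler_pdivrMr// => KN.
  rewrite mulrA ler_pdivrMr// [leRHS]mulrC; apply: KN.
  by apply: le_trans NN; rewrite le_max lexx.
have kB : `|k| <= e / 100 * sg.
  have : 10 / e <= N `^ (1 / 3) by apply: hN2; apply: le_trans NN; rewrite le_max lexx orbT.
  move=> /le_trans /(_ Nsg); rewrite ler_pdivrMr// => es.
  by lra.
have sB : s <= (e / 100 * sg / 20) ^+ 2.
  rewrite (_ : _ ^+ 2 = (e / 100 / 20) ^+ 2 * sg ^+ 2); last by field.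
  by apply: (le_trans ss); rewrite ler_wpM2l// sqr_ge0.
have := lower_tail z01 wz e0 ec ce sg0 mE nE GE zE kB s400 sB k10.
set A := (X in expR X <= _); set X := P _ => PA.
have AX : ((expR A)%:E <= X)%E by apply: fineW PA; exact: expR_gt0.
apply: (@le_trans _ _ (lne (expR A)%:E)).
  rewrite lne_EFin ?expR_gt0// expRK lee_fin /A powR32; last by lra.
  have t2 : s ^+ 2 / sg <= s ^+ 2 / N `^ (1 / 3).
    by rewrite ler_wpM2l ?sqr_ge0// lef_pV2 ?posrE.
  have t3 : 20 / e * (s ^+ 2 / sg) <= 20 / e * (s ^+ 2 / N `^ (1 / 3)).
    by rewrite ler_wpM2l// divr_ge0// ltW.
  lra.
by rewrite lee_lne ?in_itv/= ?leey ?andbT ?lee_fin ?expR_ge0// measure_ge0.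
Qed.
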